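(* Suppose $X$ is a metric space, $f:X\to\mathbb{R}_\infty$, $\bar x\in X$, $\varphi\in\mathcal{C}^1$, $\delta\in]0,+\infty]$ and $\mu\in]0,+\infty]$. (i) Let $X$ be complete, $f$ be lower semicontinuous, $\alpha\in]0,1]$, and either $\bar x\in[f\le0]$ or $\delta=+\infty$. Then $f$ admits a $\varphi$-error bound at $\bar x$ with $\delta':=\frac{\delta}{1+\alpha}$ and $\mu$, provided that one of the following conditions is satisfied: (a) $\alpha|\nabla(\varphi\circ f)|^\diamond(u)\ge1$ for all $u\in B_\delta(\bar x)\cap[0<f<\mu]$ satisfying $$\max\{\alpha,1-\alpha\}\,\varphi(f(u))<d(u,[f\le0]);\qquad( * )$$ (b) $|\breve\nabla f|\in|\mathfrak{D}f|^\circ$ and $\alpha\varphi'(f(u))|\breve\nabla f|(u)\ge1$ for all $u\in B_\delta(\bar x)\cap[0<f<\mu]$ satisfying $( * )$. If $\varphi'$ is nonincreasing, then $|\mathfrak{D}f|^\circ$ in (b) can be replaced with $|\mathfrak{D}f|$. (ii) If $f$ admits a $\varphi$-error bound at $\bar x$ with $\delta$ and $\mu$, then $|\nabla(\varphi\circ f)|^\diamond(u)\ge1$ for all $u\in B_\delta(\bar x)\cap[0<f<\mu]$. (iii) Let $X$ be a normed space, and $f$ be convex. If $f$ admits a $\varphi$-error bound at $\bar x$ with $\delta$ and $\mu$, then $\frac{\varphi(f(u))}{f(u)}|\partial f|(u)\ge1$ for all $u\in B_\delta(\bar x)\cap[0<f<\mu]$. If, moreover, $\varphi'$ is nondecreasing,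 particularly if $\varphi$ is convex, then $\varphi'(f(u))|\partial f|(u)\ge1$ for all $u\in B_\delta(\bar x)\cap[0<f<\mu]$.
   Context: Notation: $\mathbb{R}_\infty=\mathbb{R}\cup\{+\infty\}$, $\mathbb{R}_+=[0,+\infty[$, $a_+=\max\{a,0\}$; $B_\delta(x)$ is the open ball, $B_{+\infty}(x)=X$; $d(x,\Omega)=\inf_{u\in\Omega}d(x,u)$ with $d(x,\emptyset)=+\infty$. For $f:X\to\mathbb{R}_\infty$: $\mathrm{dom} f=\{x\mid f(x)<+\infty\}$, $[f\le0]=\{x\mid f(x)\le0\}$, $[0<f<\mu]=\{x\mid 0<f(x)<\mu\}$. Normed spaces are metric spaces with the distance induced by the norm; $X^*$ is the dual. Classes of functions: $\mathcal{C}$ is the family of $\varphi:\mathbb{R}_+\to\mathbb{R}_+$ with $\varphi(0)=0$ and $\varphi(t)>0$ for $t>0$. $\mathcal{C}^1$ is the family of $\varphi\in\mathcal{C}$ which satisfy $\lim_{t\to+\infty}\varphi(t)=+\infty$ and are continuously differentiable on $]0,+\infty[$ with $\varphi'(t)>0$ for all $t>0$; such $\varphi$ are continuous at $0$, so that $\varphi:\mathbb{R}_+\to\mathbb{R}_+$ is a bijection and $\varphi^{-1}\in\mathcal{C}^1$. In compositions $\varphi\circ f$, $\varphi$ is extended by $\varphi(t)=0$ for $t<0$ and $\varphi(+\infty)=+\infty$. Monotonicity of $\varphi'$ refers to $]0,+\infty[$. Error bound: for $\varphi\in\mathcal{C}$, $f$ admits a $\varphi$-error bound at $\bar x$ with $\delta\in]0,+\infty]$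 and $\mu\in]0,+\infty]$ if $d(x,[f\le0])\le\varphi(f(x))$ for all $x\in B_\delta(\bar x)\cap[0<f<\mu]$, and either $\bar x\in[f\le0]$ or $\delta=+\infty$. Slopes of a function $g:X\to\mathbb{R}_\infty$: for $x\in\mathrm{dom}\, g$, $|\nabla g|(x)=\limsup_{u\to x,\,u\ne x}\frac{[g(x)-g(u)]_+}{d(u,x)}$ (slope) and $|\nabla g|^\diamond(x)=\sup_{u\ne x}\frac{[g(x)-g_+(u)]_+}{d(u,x)}$ (nonlocal slope), where $g_+(u)=\max\{g(u),0\}$; both are $+\infty$ for $x\notin\mathrm{dom}\, g$. Subdifferentials in a normed space, for $x\in\mathrm{dom} f$ (all are empty for $x\notin\mathrm{dom} f$): Fréchet, $\partial^Ff(x)=\{x^*\in X^*\mid\liminf_{u\to x,u\neq x}\frac{f(u)-f(x)-\langle x^*,u-x\rangle}{\|u-x\|}\ge0\}$; Clarke, $\partial^Cf(x)=\{x^*\in X^*\mid\langle x^*,z\rangle\le f^\circ(x;z)\ \forall z\in X\}$, where $f^\circ(x;z)=\lim_{\varepsilon\downarrow0}\limsup_{(u,a)\to(x,f(x)),\,f(u)\le a,\,t\downarrow0}\inf_{\|z'-z\|<\varepsilon}\frac{f(u+tz')-a}{t}$. For convex $f$ both coincide with the convex subdifferential $\partial f(x)=\{x^*\in X^*\mid f(u)-f(x)-\langle x^*,u-x\rangle\ge0\ \forall u\in X\}$. Subdifferential slopes: $|\partial^Ff|(x)=d(0,\partial^Ff(x))$, $|\partial^Cf|(x)=d(0,\partial^Cf(x))$,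 $|\partial f|(x)=d(0,\partial f(x))$ (in the dual norm). Collections of slope operators: $|\mathfrak{D}f|^\circ$ contains $|\nabla f|$; if $X$ is a Banach space it also contains $|\partial^Cf|$; if $X$ is an Asplund space (a Banach space in which every separable subspace has separable dual) it also contains $|\partial^Ff|$. $|\mathfrak{D}f|=|\mathfrak{D}f|^\circ\cup\{|\nabla f|^\diamond\}$. *)

(* Defs.v *)
From HB Require Import structures.
From mathcomp Require Import all_boot all_order all_algebra.
From mathcomp Require Import all_classical all_reals all_analysis.

Set Implicit Arguments.
Unset Strict Implicit.
Unset Printing Implicit Defensive.

Import Order.TTheory GRing.Theory Num.Theory.
Import numFieldNormedType.Exports.

Local Open Scope classical_set_scope.
Local Open Scope ring_scope.
Local Open Scope ereal_scope.

(* Functions X -> R u {+oo} are functions X -> \bar R that avoid -oo. *)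
Definition proper_valued (X : Type) (R : realType) (f : X -> \bar R) : Prop :=
  forall x, f x != -oo.

(* Elements of the class C are functions R -> R used on [0, +oo[ only. *)
Definition class_C (R : realType) (phi : R -> R) : Prop :=
  phi 0%R = 0%R /\ (forall t : R, (0 < t)%R -> (0 < phi t)%R).

(* Right-continuity at 0 is not a consequence of the other clauses
   (consider t + 1 on ]0, +oo[): it is part of the class, and it is what makes
   phi a bijection of [0, +oo[. *)
Definition class_C1 (R : realType) (phi : R -> R) : Prop :=
  [/\ class_C phi,
      phi t @[t --> +oo%R] --> +oo%R,
      phi t @[t --> 0%R^'+] --> phi 0%R
    & forall t : R, (0 < t)%R ->
        [/\ derivable phi t 1%R, {for t, continuous phi^`()%classic}
          & (0 < phi^`()%classic t)%R] ].

(* phi extended by 0 on negative numbers and by phi(+oo) = +oo; the value at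
   -oo is never used. *)
Definition extend (R : realType) (phi : R -> R) (y : \bar R) : \bar R :=
  match y with
  | r%:E => if (r < 0)%R then 0 else (phi r)%:E
  | +oo => +oo
  | -oo => 0
  end.

Section metric.
Context (R : realType) (X : metricType R).
Implicit Types (f g : X -> \bar R) (x : X).

Definition complete_metric : Prop :=
  forall F : set_system X, ProperFilter F -> cauchy F ->
    exists l : X, F --> l.

(* the open ball, with an extended radius; the whole space if delta = +oo *)
Definition eball x (delta : \bar R) : set X :=
  [set u | (mdist x u)%:E < delta].

Definition dist_to x (A : set X) : \bar R :=
  ereal_inf [set (mdist x u)%:E | u in A].

Definition sublevel0 f : set X := [set x | f x <= 0].

Definition strip f (mu : \bar R) : set X := [set x | 0 < f x < mu].

Definition error_bound (phi : R -> R) f x (delta mu : \bar R) : Prop :=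
  (forall u, (eball x delta `&` strip f mu) u ->
     dist_to u (sublevel0 f) <= extend phi (f u)) /\
  (sublevel0 f x \/ delta = +oo).

(* Both slopes are suprema (limits of suprema) of nonnegative quantities, so
   that the supremum of the empty family is 0; the maximum with 0 makes up for
   ereal_sup set0 = -oo, which occurs at isolated points. *)
Definition slope g x : \bar R :=
  if g x == +oo then +oo else
  maxe 0 (limf_esup
    (fun u => maxe (g x - g u) 0 * ((mdist u x)^-1)%:E) x^').

Definition nonlocal_slope g x : \bar R :=
  if g x == +oo then +oo else
  maxe 0 (ereal_sup
    [set maxe (g x - maxe (g u) 0) 0 * ((mdist u x)^-1)%:E
    | u in [set u | u != x]]).

End metric.

Section normed_metric.
Context (R : realType) (V : normedModType R).

Let dist (x y : V) : R := `|y - x|%R.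

Let dist_ge0 x y : (0 <= dist x y)%R.
Proof. exact: normr_ge0. Qed.

Let dist_positivity x y : dist x y = 0%R -> x = y.
Proof. by move/normr0_eq0/eqP; rewrite subr_eq0 => /eqP. Qed.

Let ballEdist x d : ball x d = [set y | (dist x y < d)%R].
Proof. by rewrite -ball_normE; apply/seteqP; split => y /=; rewrite distrC. Qed.

(* A normed space as a metric space for the distance induced by the norm. It
   is not declared canonical: R^o, for one, already has a metric structure. *)
Definition normed_metric : metricType R :=
  HB.pack (NormedModule.sort V)
    (PseudoMetric_isMetric.Build R V dist_ge0 dist_positivity ballEdist).

End normed_metric.

Section dual.
Context (R : realType) (V : normedModType R).
Implicit Types (W : set V) (f : V -> \bar R) (x z : V).

Definition is_subspace W : Prop :=
  W 0%R /\ forall (a : R) (u v : V), W u -> W v -> W (a *: u + v)%R.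

(* The dual of the subspace W: functions on V of which only the values on W
   matter. The dual of V is the case W = setT. *)
Definition dual_on W : set (V -> R) :=
  [set g | (forall (a : R) (u v : V), W u -> W v ->
              g (a *: u + v)%R = (a * g u + g v)%R) /\
           {within W, continuous g}].

Definition dual_norm_on W (g : V -> R) : \bar R :=
  ereal_sup [set `|g u|%:E | u in [set u | W u /\ (`|u| <= 1)%R]].

Definition separable_on W : Prop :=
  exists D : set V, [/\ countable D, D `<=` W & W `<=` closure D].

Definition separable_dual_on W : Prop :=
  exists D : set (V -> R), [/\ countable D, D `<=` dual_on W
    & forall g, dual_on W g -> forall e : R, (0 < e)%R ->
        exists2 h, D h & dual_norm_on W (g \- h)%R < e%:E].

(* to be applied to Banach spaces *)
Definition asplund : Prop :=
  forall W, is_subspace W -> separable_on W -> separable_dual_on W.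

Definition dual : set (V -> R) := dual_on setT.
Definition dual_norm (g : V -> R) : \bar R := dual_norm_on setT g.

Definition convex_efun f : Prop :=
  forall (x y : V) (t : R), (0 <= t <= 1)%R ->
    f (t *: x + (1 - t) *: y)%R <= t%:E * f x + (1 - t)%:E * f y.

Definition subdiff f x : set (V -> R) :=
  [set xs | [/\ f x < +oo, dual xs
    & forall u, 0 <= f u - f x - (xs (u - x)%R)%:E] ].

Definition frechet_subdiff f x : set (V -> R) :=
  [set xs | [/\ f x < +oo, dual xs
    & 0 <= limf_einf
        (fun u => (f u - f x - (xs (u - x)%R)%:E) * (`|u - x|^-1)%:E) x^'] ].

(* the Clarke-Rockafellar derivative of f at a point x of its domain; the
   points of the filter are triples (u, a, t) *)
Definition clarke_dd f x z : \bar R :=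
  lim ((limf_esup
    (fun p : V * R * R => let: (u, a, t) := p in
       ereal_inf [set (f (u + t *: z')%R - a%:E) * (t^-1)%:E
                 | z' in [set z' | (`|z' - z| < eps)%R]])
    (filter_prod
       (within [set ua : V * R | f ua.1 <= ua.2%:E] (nbhs (x, fine (f x))))
       (0%R : R)^'+)) @[eps --> (0%R : R)^'+]).

Definition clarke_subdiff f x : set (V -> R) :=
  [set xs | [/\ f x < +oo, dual xs
    & forall z, (xs z)%:E <= clarke_dd f x z] ].

(* d(0, D x) for the dual norm; +oo if D x is empty *)
Definition subdiff_slope (D : V -> set (V -> R)) x : \bar R :=
  ereal_inf [set dual_norm xs | xs in D x].

End dual.

(* The collection |Df|^o of slope operators of f : X -> \bar R. The metric space
   X is an index of the family: when X is the metric space of a Banach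
   (Asplund) space, the collection contains the Clarke (Frechet) subdifferential
   slope as well. *)
Inductive slope_ops0 (R : realType) :
    forall X : metricType R, (X -> \bar R) -> (X -> \bar R) -> Prop :=
| Slope_op (X : metricType R) (f : X -> \bar R) :
    slope_ops0 f (slope f)
| Clarke_op (V : completeNormedModType R) (f : normed_metric V -> \bar R) :
    @slope_ops0 R (normed_metric V) f (@subdiff_slope R V (clarke_subdiff f))
| Frechet_op (V : completeNormedModType R) (f : normed_metric V -> \bar R) :
    asplund V ->
    @slope_ops0 R (normed_metric V) f (@subdiff_slope R V (frechet_subdiff f)).

Definition slope_ops (R : realType) (X : metricType R) (f : X -> \bar R)
    (s : X -> \bar R) : Prop :=
  slope_ops0 f s \/ s = nonlocal_slope f.

(* Main.v *)
Require Import Defs.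
From HB Require Import structures.
From mathcomp Require Import all_boot all_order all_algebra.
From mathcomp Require Import all_classical all_reals all_analysis.
From mathcomp Require Import ring lra.

Set Implicit Arguments.
Unset Strict Implicit.
Unset Printing Implicit Defensive.

Import Order.TTheory GRing.Theory Num.Theory.
Import numFieldNormedType.Exports.

Local Open Scope classical_set_scope.
Local Open Scope ring_scope.

(** Sufficiency. If the error bound fails at x, then phi (f x) lies below
    the distance from x to the sublevel set S. Ekeland's principle for phi o f
    provides u near x such that phi o f + k d(., u) is minimal at u, for some
    k < 1 / alpha; the bound d(u, x) <= alpha d(x, S) that comes with it puts u
    in the set of points where the slope conditions are assumed
    ([error_bound_failure]). The nonlocal slope of phi o f at u is at most k, which
    settles the condition on that slope. As phi is differentiable and increasing, u
    is also a local minimizer of f + c d(., u) as soon as c > k / phi' (f u)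
    ([local_descent]), and when phi' is nonincreasing the nonlocal slope of f at
    u is at most k / phi' (f u) ([nonlocal_descent]). For the other conditions, it
    remains to bound the slopes of f in terms of c ([slope_ops0_near]).

    For the slope |nabla f| this is the definition. For the Clarke
    subdifferential, local minimality says that the sublinear function
    clarke_dd f u dominates - c |.|, and a linear functional separates them
    ([sandwich], [clarke_subdiff_slope_le]).

    For the Frechet subdifferential in an Asplund space, a subgradient is only
    found at points near u, and this is the fuzzy sum rule for f and c |. - u|.
    On a subspace W that is separable, the dual of W is separable, so that the norm
    of W is a uniform limit of 1-Lipschitz functions which are Frechet
    superdifferentiable everywhere ([smooth_norm]). A variational principle of
    Borwein and Preiss with penalties built from these functions
    ([variational_principle]) then gives y near u at which f has Frechet
    eps-subgradients along W for every eps, and these are Cauchy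
    ([no_obstruction_near]). To go from W to the whole space, the existence of a
    Frechet subgradient of norm at most c is expressed, through the separation
    theorem, as the absence of certain finite configurations of points
    ([frechet_subdiff_slope_le]); since the presence of a configuration is an open
    condition, W can be chosen in such a way that a configuration in the space can
    be replaced by one in W ([separable_reduction]).

    Necessity. A point v of S at distance almost phi (f u) from u shows that the
    nonlocal slope of phi o f at u is at least 1; and a subgradient xs at u satisfies
    f u <= xs (u - v) <= |xs| |u - v|. Finally, phi t / t <= phi' t by the mean value theorem when phi' is nondecreasing, and by comparison of
    difference quotients when phi is convex. *)

(** * Separation of a convex cone from the norm *)

Section hahn_banach.
Context (R : realType) (V : lmodType R).

Definition sublinear (p : V -> R) : Prop :=
  (forall x y, p (x + y) <= p x + p y) /\
  (forall t x, 0 <= t -> p (t *: x) = t * p x).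

Lemma sublinear0 p : sublinear p -> p 0 = 0.
Proof. by move=> [_ h]; have := h 0 0 (lexx _); rewrite scale0r mul0r. Qed.

Lemma sublinear_of_le p : (forall x y, p (x + y) <= p x + p y) -> p 0 = 0 ->
  (forall t x, 0 < t -> p (t *: x) <= t * p x) -> sublinear p.
Proof.
move=> pD p0 pZ; split=> // t x; rewrite le_eqVlt => /orP[/eqP<-|t0].
  by rewrite scale0r mul0r.
apply/eqP; rewrite eq_le pZ//= -ler_pdivlMl//.
have := pZ t^-1 (t *: x); rewrite invr_gt0 => /(_ t0).
by rewrite scalerA mulVf ?gt_eqF// scale1r.
Qed.

(** For a fixed h, the function z |-> inf_(t >= 0) p (z + t h) - t p h is sublinear
    and below p, hence equal to p by minimality; its value at - h is at most
    - p h. *)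
Lemma minimal_sublinear_linear (p : V -> R) : sublinear p ->
  (forall p', sublinear p' -> (forall x, p' x <= p x) -> p' = p) ->
  forall a x y, p (a *: x + y) = a * p x + p y.
Proof.
move=> sp pmin; have [pD pZ] := sp; have p0 := sublinear0 sp.
have pN h : p (- h) = - p h.
  pose E z := [set p (z + t *: h) - t * p h | t in [set t : R | 0 <= t]].
  pose ph z := inf (E z).
  have E0 z : E z !=set0 by exists (p (z + 0 *: h) - 0 * p h); exists 0 => /=.
  have Elb z : lbound (E z) (- p (- z)).
    move=> _ [t /= t0 <-]; rewrite -pZ//.
    have := pD (z + t *: h) (- z); rewrite addrAC subrr add0r; lra.
  have Ehas z : has_inf (E z) by split => //; exists (- p (- z)); exact: Elb.
  have phle z (t : R) : 0 <= t -> ph z <= p (z + t *: h) - t * p h.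
    by move=> t0; apply: ge_inf; [exists (- p (- z)); exact: Elb|exists t].
  have php z : ph z <= p z.
    by have := phle z 0 (lexx _); rewrite scale0r addr0 mul0r subr0.
  have ph_pos : sublinear ph.
    apply: sublinear_of_le.
    - move=> x y; apply/ler_addgt0Pr => e e0.
      have e2 : 0 < e / 2 by lra.
      have [_ [t /= t0 <-] ht] := inf_adherent e2 (Ehas x).
      have [_ [s /= s0 <-] hs] := inf_adherent e2 (Ehas y).
      have := phle (x + y) (t + s) (addr_ge0 t0 s0).
      have := pD (x + t *: h) (y + s *: h).
      rewrite addrACA -scalerDl mulrDl; rewrite -/(ph x) -/(ph y) in ht hs; lra.
    - apply/eqP; rewrite eq_le; apply/andP; split; first by rewrite -p0.
      by apply: lb_le_inf => //; have := Elb 0; rewrite oppr0 p0 oppr0.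
    - move=> t x t0; rewrite -ler_pdivrMl//; apply: lb_le_inf => // _ [s /= s0 <-].
      rewrite ler_pdivrMl//; have := phle (t *: x) (t * s) (mulr_ge0 (ltW t0) s0).
      by rewrite -scalerA -scalerDr pZ ?(ltW t0)// mulrBr mulrA.
  have E' := pmin _ ph_pos php.
  have := phle (- h) 1 ler01; rewrite E' scale1r addNr p0 mul1r => h1.
  by have := pD h (- h); rewrite subrr p0; lra.
have pDe x y : p (x + y) = p x + p y.
  have := pD (x + y) (- y); rewrite addrK pN.
  by have := pD x y; lra.
have pZe a x : p (a *: x) = a * p x.
  have [a0|a0] := leP 0 a; first exact: pZ.
  have := pZ (- a) x; rewrite scaleNr pN oppr_ge0 => /(_ (ltW a0)); lra.
by move=> a x y; rewrite pDe pZe.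
Qed.

(** Zorn's lemma for the pointwise order provides a minimal element among the
    sublinear functionals below q. *)
Lemma hahn_banach (q : V -> R) : sublinear q ->
  exists2 g : V -> R, (forall a x y, g (a *: x + y) = a * g x + g y) &
    forall x, g x <= q x.
Proof.
move=> sq.
pose T := {p : V -> R | sublinear p /\ forall x, p x <= q x}.
pose Rl (s t : T) := `[< forall x, sval t x <= sval s x >].
have lbq (s : T) x : - q (- x) <= sval s x.
  case: s => p [sp pq] /=; have [pD _] := sp.
  have := pD x (- x); rewrite subrr (sublinear0 sp).
  by have := pq (- x); lra.
have [t tmin] : exists t, forall s, Rl t s -> s = t.
  apply: Zorn.
  - by move=> t; apply/asboolP.
  - move=> r s t /asboolP rs /asboolP st; apply/asboolP => x.
    exact: le_trans (st x) (rs x).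
  - move=> [s hs] [t ht] /asboolP /= st /asboolP /= ts.
    have e : s = t by apply/funext => x; apply/le_anti; rewrite st ts.
    by subst t; congr exist; exact: Prop_irrelevance.
  - move=> A tot.
    have [A0|/set0P[a0 Aa0]] := eqVneq A set0.
      exists (exist _ q (conj sq (fun x => lexx _))) => s.
      by rewrite A0.
    pose E x := [set sval s x | s in A].
    have E0 x : E x !=set0 by exists (sval a0 x); exists a0.
    have Elb x : lbound (E x) (- q (- x)) by move=> _ [s _ <-]; exact: lbq.
    have Ehas x : has_inf (E x) by split => //; exists (- q (- x)); exact: Elb.
    pose m x := inf (E x).
    have mle s x : A s -> m x <= sval s x.
      move=> As; apply: ge_inf; last by exists s.
      by exists (- q (- x)); exact: Elb.
    have sm : sublinear m.
      apply: sublinear_of_le.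
      - move=> x y; apply/ler_addgt0Pr => e e0.
        have e2 : 0 < e / 2 by lra.
        have [_ [s As <-] hs] := inf_adherent e2 (Ehas x).
        have [_ [t At <-] ht] := inf_adherent e2 (Ehas y).
        rewrite -/(m x) -/(m y) in hs ht.
        have [r [Ar rs rt]] : exists r, [/\ A r, forall z, sval r z <= sval s z &
            forall z, sval r z <= sval t z].
          have [/asboolP h|/asboolP h] := tot _ _ As At; first by exists t.
          by exists s.
        have := mle _ (x + y) Ar; have := (svalP r).1.1 x y.
        by have := rs x; have := rt y; lra.
      - apply/eqP; rewrite eq_le; apply/andP; split.
          by have := mle _ 0 Aa0; rewrite (sublinear0 (svalP a0).1).
        by apply: lb_le_inf => //; have := Elb 0;
           rewrite oppr0 (sublinear0 sq) oppr0.
      - move=> t x t0; rewrite -ler_pdivrMl//; apply: lb_le_inf => // _ [s As <-].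
        rewrite ler_pdivrMl//; have := mle _ (t *: x) As.
        by rewrite (svalP s).1.2// ltW.
    have mq x : m x <= q x by rewrite (le_trans (mle _ _ Aa0))// (svalP a0).2.
    exists (exist _ m (conj sm mq)) => s As; apply/asboolP => x /=.
    exact: mle.
have [st tq] := svalP t.
exists (sval t) => //; apply: minimal_sublinear_linear => // p' sp' p'le.
have p'q x : p' x <= q x by exact: le_trans (p'le x) (tq x).
by have := tmin (exist _ p' (conj sp' p'q)) (asboolT p'le) => <-.
Qed.

End hahn_banach.

Section sandwich.
Context (R : realType) (V : normedModType R).

Lemma nat_ratio_approx (t e : R) : 0 <= t -> 0 < e ->
  exists k m : nat, (0 < m)%N /\ `|t - k%:R / m%:R| < e.
Proof.
move=> t0 e0; pose m := (Num.truncn e^-1).+1; pose k := Num.truncn (t * m%:R).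
have m0 : 0 < m%:R :> R by rewrite ltr0n.
have /andP[kle ltk] := @truncn_itv _ (t * m%:R) (mulr_ge0 t0 (ltW m0)).
exists k, m; split => //.
have em : e^-1 < m%:R by rewrite /m truncnS_gt.
have em1 : 1 < e * m%:R by rewrite -ltr_pdivrMl// mulr1.
rewrite -(@ltr_pM2r _ m%:R)// -[X in _ * X < _]gtr0_norm// -normrM mulrBl.
rewrite divfK ?gt_eqF// ger0_norm ?subr_ge0//.
rewrite -/k -natr1 in ltk; lra.
Qed.

(** Since real scalars are limits of ratios of naturals, the additive semigroup C
    generates a closed convex cone K on which r >= - c |h| still holds. Then
    z |-> inf (r + c |z - h|), over the pairs (h, r) in K, is sublinear, and a linear
    functional below it is below c |.| everywhere and below r on C. *)
Lemma sandwich (C : V -> R -> Prop) (c : R) : 0 <= c -> C 0 0 ->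
  (forall h r h' r', C h r -> C h' r' -> C (h + h') (r + r')) ->
  (forall h r, C h r -> - (c * `|h|) <= r) ->
  exists g : V -> R, [/\ forall a x y, g (a *: x + y) = a * g x + g y,
    forall x, `|g x| <= c * `|x| & forall h r, C h r -> g h <= r].
Proof.
move=> c0 C0 CD Clb.
pose K h r := forall e, 0 < e -> exists h' r' (m : nat), [/\ C h' r', (0 < m)%N,
  `|h - m%:R^-1 *: h'| <= e & `|r - m%:R^-1 * r'| <= e].
have CM h r k : C h r -> C (k%:R *: h) (k%:R * r).
  move=> Ch; elim: k => [|k IH]; first by rewrite scale0r mul0r.
  by rewrite -natr1 scalerDl mulrDl scale1r mul1r; exact: CD.
have CK h r : C h r -> K h r.
  by move=> Ch e e0; exists h, r, 1%N; split => //;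
    rewrite invr1 ?scale1r ?mul1r subrr normr0 ltW.
have KD h r h' r' : K h r -> K h' r' -> K (h + h') (r + r').
  move=> Kh Kh' e e0; have e2 : 0 < e / 2 by lra.
  have [h1 [r1 [m1 [C1 m10 a1 b1]]]] := Kh _ e2.
  have [h2 [r2 [m2 [C2 m20 a2 b2]]]] := Kh' _ e2.
  have m1n : m1%:R != 0 :> R by rewrite pnatr_eq0 -lt0n.
  have m2n : m2%:R != 0 :> R by rewrite pnatr_eq0 -lt0n.
  exists (m2%:R *: h1 + m1%:R *: h2), (m2%:R * r1 + m1%:R * r2), (m1 * m2)%N.
  split.
  - by apply: CD; exact: CM.
  - by rewrite muln_gt0 m10.
  - rewrite natrM scalerDr !scalerA.
    have -> : (m1%:R * m2%:R)^-1 * m2%:R = m1%:R^-1 :> R by field; rewrite m1n m2n.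
    have -> : (m1%:R * m2%:R)^-1 * m1%:R = m2%:R^-1 :> R by field; rewrite m1n m2n.
    rewrite opprD addrACA (le_trans (ler_normD _ _))//; lra.
  - rewrite natrM mulrDr !mulrA.
    have -> : (m1%:R * m2%:R)^-1 * m2%:R = m1%:R^-1 :> R by field; rewrite m1n m2n.
    have -> : (m1%:R * m2%:R)^-1 * m1%:R = m2%:R^-1 :> R by field; rewrite m1n m2n.
    rewrite opprD addrACA (le_trans (ler_normD _ _))//; lra.
have KZ t h r : 0 <= t -> K h r -> K (t *: h) (t * r).
  move=> t0 Kh e e0.
  pose M := 2 * (1 + t + `|h| + `|r|); have M0 : 0 < M.
    by rewrite /M; have := normr_ge0 h; have := normr_ge0 r; lra.
  pose d := Num.min 1 (e / M).
  have d0 : 0 < d by rewrite lt_min ltr01/= divr_gt0.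
  have d1 : d <= 1 by rewrite ge_min lexx.
  have dM : d * M <= e by rewrite -ler_pdivlMr// ge_min lexx orbT.
  have [h1 [r1 [m1 [C1 m10 a1 b1]]]] := Kh _ d0.
  have [k [m [m0 km]]] := nat_ratio_approx t0 d0.
  have m1n : m1%:R != 0 :> R by rewrite pnatr_eq0 -lt0n.
  have mn : m%:R != 0 :> R by rewrite pnatr_eq0 -lt0n.
  exists (k%:R *: h1), (k%:R * r1), (m * m1)%N; split.
  - exact: CM.
  - by rewrite muln_gt0 m0.
  - have -> : t *: h - (m * m1)%:R^-1 *: (k%:R *: h1) =
        t *: (h - m1%:R^-1 *: h1) + (t - k%:R / m%:R) *: h
        - (t - k%:R / m%:R) *: (h - m1%:R^-1 *: h1).
      rewrite !(scalerBr _ h) -addrA opprB (addrC ((t - _) *: h)) subrK.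
      rewrite [(t - _) *: _]scalerBl addrA subrK !scalerA natrM.
      by congr (_ - _ *: _); field; rewrite mn m1n.
    rewrite (le_trans (ler_normB _ _))// (le_trans (lerD (ler_normD _ _) (lexx _)))//.
    rewrite !normrZ (ger0_norm t0).
    have A1 : t * `|h - m1%:R^-1 *: h1| <= t * d by rewrite ler_wpM2l.
    have A2 : `|t - k%:R / m%:R| * `|h| <= d * `|h| by rewrite ler_wpM2r// ltW.
    have A3 : `|t - k%:R / m%:R| * `|h - m1%:R^-1 *: h1| <= d * 1.
      by apply: ler_pM => //; [exact: ltW | exact: le_trans a1 d1].
    rewrite (le_trans _ dM)// /M.
    have := mulr_ge0 (ltW d0) (normr_ge0 r).
    have := mulr_ge0 (ltW d0) (normr_ge0 h).
    have := mulr_ge0 (ltW d0) t0.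
    by rewrite !mulrDr; nra.
  - have -> : t * r - (m * m1)%:R^-1 * (k%:R * r1) =
        t * (r - m1%:R^-1 * r1) + (t - k%:R / m%:R) * r
        - (t - k%:R / m%:R) * (r - m1%:R^-1 * r1).
      by rewrite natrM; field; rewrite mn m1n.
    rewrite (le_trans (ler_normB _ _))// (le_trans (lerD (ler_normD _ _) (lexx _)))//.
    rewrite !normrM (ger0_norm t0).
    have A1 : t * `|r - m1%:R^-1 * r1| <= t * d by rewrite ler_wpM2l.
    have A2 : `|t - k%:R / m%:R| * `|r| <= d * `|r| by rewrite ler_wpM2r// ltW.
    have A3 : `|t - k%:R / m%:R| * `|r - m1%:R^-1 * r1| <= d * 1.
      by apply: ler_pM => //; [exact: ltW | exact: le_trans b1 d1].
    rewrite (le_trans _ dM)// /M.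
    have := mulr_ge0 (ltW d0) (normr_ge0 r).
    have := mulr_ge0 (ltW d0) (normr_ge0 h).
    have := mulr_ge0 (ltW d0) t0.
    by rewrite !mulrDr; nra.
have Klb h r : K h r -> - (c * `|h|) <= r.
  move=> Kh; apply/ler_addgt0Pr => e e0.
  have d0 : 0 < e / (1 + c) by rewrite divr_gt0//; lra.
  have [h1 [r1 [m1 [C1 m10 a1 b1]]]] := Kh _ d0.
  have m10' : 0 < m1%:R^-1 :> R by rewrite invr_gt0 ltr0n.
  have h1r1 := Clb _ _ C1.
  have {}h1r1 : - (c * `|m1%:R^-1 *: h1|) <= m1%:R^-1 * r1.
    by rewrite normrZ gtr0_norm// mulrCA -mulrN ler_pM2l.
  have A : `|m1%:R^-1 *: h1| <= `|h| + e / (1 + c).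
    rewrite -[X in `|X|](subKr h) (le_trans (ler_normB _ _))// lerD2l//.
  have B := ler_norm (- (r - m1%:R^-1 * r1)); rewrite normrN in B.
  have D : c * `|m1%:R^-1 *: h1| <= c * (`|h| + e / (1 + c)) by rewrite ler_wpM2l.
  have E : (1 + c) * (e / (1 + c)) = e by field; lra.
  rewrite mulrDr in D; rewrite mulrDl mul1r in E; lra.
pose E z := [set x.2 + c * `|z - x.1| | x in [set x : V * R | K x.1 x.2]].
have K0 : K 0 0 by exact: CK.
have E0 z : E z !=set0 by exists (0 + c * `|z - 0|); exists (0, 0).
have Elb z : lbound (E z) (- (c * `|z|)).
  move=> _ [[h r] /= Kh <-]; have := Klb _ _ Kh.
  have : c * `|h| <= c * (`|z| + `|z - h|).
    by rewrite ler_wpM2l// -[X in `|X|](subKr z) ler_normB.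
  rewrite mulrDr; lra.
have Ehas z : has_inf (E z) by split => //; exists (- (c * `|z|)); exact: Elb.
pose q z := inf (E z).
have qle z h r : K h r -> q z <= r + c * `|z - h|.
  move=> Kh; apply: ge_inf; last by exists (h, r).
  by exists (- (c * `|z|)); exact: Elb.
have sq : sublinear q.
  apply: sublinear_of_le.
  - move=> x y; apply/ler_addgt0Pr => e e0.
    have e2 : 0 < e / 2 by lra.
    have [_ [[h r] /= Kh <-] hx] := inf_adherent e2 (Ehas x).
    have [_ [[h' r'] /= Kh' <-] hy] := inf_adherent e2 (Ehas y).
    rewrite -/(q x) -/(q y) in hx hy.
    have := qle (x + y) _ _ (KD _ _ _ _ Kh Kh').
    have : c * `|x + y - (h + h')| <= c * (`|x - h| + `|y - h'|).
      by rewrite ler_wpM2l// opprD addrACA ler_normD.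
    rewrite mulrDr; lra.
  - apply/eqP; rewrite eq_le; apply/andP; split.
      by have := qle 0 _ _ K0; rewrite subrr normr0 mulr0 addr0.
    by apply: lb_le_inf => //; have := Elb 0; rewrite normr0 mulr0 oppr0.
  - move=> t x t0; rewrite -ler_pdivrMl//.
    apply: lb_le_inf => // _ [[h r] /= Kh <-]; rewrite ler_pdivrMl//.
    have := qle (t *: x) _ _ (KZ _ _ _ (ltW t0) Kh).
    by rewrite -scalerBr normrZ (gtr0_norm t0) mulrDr mulrCA.
have [g glin gq] := hahn_banach sq.
have gN x : g (- x) = - g x.
  have g0 : g 0 = 0 by have := glin 1 0 0; rewrite scale1r addr0 mul1r; lra.
  by have := glin (-1) x 0; rewrite scaleN1r addr0 mulN1r g0 addr0.
have gle x : g x <= c * `|x|.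
  by have := qle x _ _ K0; rewrite subr0 add0r; exact: le_trans (gq x).
exists g; split => //.
- move=> x; rewrite ler_norml gle andbT.
  by have := gle (- x); rewrite gN normrN; lra.
- move=> h r /CK Kh; have := qle h _ _ Kh; rewrite subrr normr0 mulr0 addr0.
  exact: le_trans (gq h).
Qed.

End sandwich.

(** * Variational principles *)

Lemma half_pow_cvg (R : realType) (t : R) : (fun n => t * 2^-1 ^+ n) @ \oo --> 0.
Proof.
rewrite -(mulr0 t); apply: cvgMl_tmp; apply: cvg_expr.
by rewrite gtr0_norm ?invf_lt1 ?ltr1n.
Qed.

Section variational_principle.
Context (R : realType) (X : metricType R).
Implicit Types (f : X -> \bar R).

Lemma geometric_cvg (a : nat -> X) (M : R) : complete_metric X ->
  (forall n, mdist (a n) (a n.+1) <= M * 2^-1 ^+ n) ->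
  exists y : X, a @ \oo --> y.
Proof.
move=> cX aM; apply: cX.
have M0 : 0 <= M by have := aM 0%N; rewrite expr0 mulr1; exact: le_trans (mdist_ge0 _ _).
have dist n k : mdist (a n) (a (n + k)%N) <= 2 * M * 2^-1 ^+ n.
  suff : mdist (a n) (a (n + k)%N) <= 2 * M * (2^-1 ^+ n - 2^-1 ^+ (n + k)).
    move=> /le_trans; apply; rewrite ler_wpM2l ?mulr_ge0// gerBl.
    by rewrite exprn_ge0// invr_ge0.
  elim: k => [|k IH]; first by rewrite addn0 mdistxx subrr mulr0.
  rewrite addnS (le_trans (metric_triangle _ (a (n + k)%N) _))//.
  have := aM (n + k)%N; rewrite exprS; lra.
apply: cauchy_exP => e e0.
have [n _ hn] : \forall n \near \oo, 2 * M * 2^-1 ^+ n < e.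
  by apply: cvgr_lt (half_pow_cvg _) _ e0.
exists (a n); exists n => // k /= nk; rewrite ballEmdist /=.
by rewrite -(subnKC nk) (le_lt_trans (dist _ _))// hn/=.
Qed.

Lemma lsc_limit_le f (a : nat -> X) (y : X) (t : R) :
  lower_semicontinuous f -> a @ \oo --> y ->
  (forall e, 0 < e -> \forall n \near \oo, (f (a n) <= (t + e)%:E)%E) ->
  (f y <= t%:E)%E.
Proof.
move=> lf ay fa; apply: contrapT => /negP; rewrite -ltNge => ty.
have [e e0 te] : exists2 e, 0 < e & ((t + e)%:E < f y)%E.
  move: ty; case: (f y) => [r| |]//.
    by rewrite lte_fin => tr; exists ((r - t) / 2); rewrite ?lte_fin; lra.
  by exists 1; rewrite ?ltry.
have [U yU Uf] := lf _ _ te.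
have [n [h1 h2]] := @filter_ex _ \oo _ _ (filterI (fa _ e0) (ay _ yU)).
by have := Uf _ h2; rewrite ltNge h1.
Qed.

(** Each a k.+1 is chosen as an almost minimizer of f + H k. The penalty
    centred at a k.+1 is almost c k.+1 times the distance to it, so the next almost
    minimizer cannot be far: the sequence is Cauchy, and y is its limit. The
    penalties added after the N-th one are (tau / 2^N)-Lipschitz altogether, whence
    the conclusion for every N. When G a s is the distance to a, N = 0 gives
    Ekeland's principle; when the functions G a s are smooth, so is H N, and
    eps-subgradients of f at y are obtained for every eps. *)
Lemma variational_principle (E : set X) f (G : X -> R -> X -> R) x0
    (s0 kappa tau m : R) :
  complete_metric X -> closed E -> lower_semicontinuous f ->
  (forall v, E v -> (m%:E <= f v)%E) -> E x0 -> (f x0 < +oo)%E ->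
  0 < s0 -> 0 < kappa -> 0 < tau ->
  (forall a s y, E a -> 0 < s -> E y -> mdist a y - s <= G a s y <= mdist a y) ->
  (forall a s y z, E a -> 0 < s -> E y -> E z ->
     `|G a s y - G a s z| <= mdist y z) ->
  let c k := if k is 0 then kappa else tau * 2^-1 ^+ k in
  exists (y : X) (a : nat -> X) (s : nat -> R),
    let H N v := \sum_(k < N.+1) c k * G (a k) (s k) v in
    [/\ E y, a 0%N = x0, s 0%N = s0, forall k, E (a k) /\ 0 < s k &
    forall N v, E v ->
      (f y + (H N y)%:E <= f v + (H N v + tau * 2^-1 ^+ N * mdist v y)%:E)%E].
Proof.
move=> cX clE lf fm Ex0 fx0 s00 kap0 tau0 Gd GL c.
have half0 n : 0 < 2^-1 ^+ n :> R by rewrite exprn_gt0// invr_gt0.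
have c0 k : 0 < c k by case: k => [|k]; rewrite /c ?mulr_gt0 ?half0.
pose s k : R := if k is 0 then s0 else 2^-1 ^+ k.
have sp k : 0 < s k by case: k => [|k] /=.
(* a k.+1 minimizes f + H k up to eta k.+1, which is small compared with the
   weight c k.+1 of the penalty centred at it *)
pose eta k : R := c k * 2^-1 ^+ k.
have eta0 k : 0 < eta k by rewrite mulr_gt0.
pose P (H : X -> R) (e : R) p := [/\ E p, (f p < +oo)%E &
  forall v, E v -> (f p + (H p)%:E <= f v + (H v + e)%:E)%E].
have fE v : E v -> (f v < +oo)%E -> f v = (fine (f v))%:E.
  move=> Ev fv; rewrite fineK// fin_numE -ltey fv andbT gt_eqF//.
  by rewrite (lt_le_trans _ (fm _ Ev))// ltNyr.
have Pex H (B e : R) : (forall v, E v -> B <= H v) -> 0 < e -> exists p, P H e p.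
  move=> HB e0.
  pose S := [set fine (f v) + H v | v in [set v | E v /\ (f v < +oo)%E]].
  have hS : has_inf S.
    split; first by exists (fine (f x0) + H x0); exists x0.
    exists (m + B) => _ [v [Ev fv] <-]; rewrite lerD ?HB//.
    by rewrite -lee_fin -fE// fm.
  have [_ [p [Ep fp] <-] hp] := inf_adherent e0 hS.
  exists p; split => // v Ev; have [fv|] := ltP (f v) +oo%E; last first.
    by rewrite leye_eq => /eqP ->; rewrite addye// leey.
  rewrite (fE _ Ep fp) (fE _ Ev fv) -!EFinD lee_fin addrA ltW//.
  rewrite (lt_le_trans hp)// lerD2r; apply: ge_inf; last by exists v.
  by have [] := hS.
pose pick H e := xget x0 (P H e).
pose st := fix st n := if n is n'.+1 then
    let p := pick (st n').1 (eta n) in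
    ((fun v => (st n').1 v + c n * G p (s n) v), p)
  else ((fun v => c 0%N * G x0 s0 v), x0).
pose a n := (st n).2; pose H n := (st n).1.
have HS n v : H n.+1 v = H n v + c n.+1 * G (a n.+1) (s n.+1) v by [].
have st_ok n : (E (a n) /\ (f (a n) < +oo)%E) /\
    exists B, forall v, E v -> B <= H n v.
  have cG k p v : E p -> E v -> - (c k * s k) <= c k * G p (s k) v.
    move=> Ep Ev; rewrite -mulrN ler_pM2l//.
    have /andP[+ _] := Gd _ _ _ Ep (sp k) Ev.
    by have := mdist_ge0 p v; lra.
  elim: n => [|n [[IHE IHf] [B HB]]].
    by split => //; exists (- (c 0%N * s 0%N)) => v Ev; exact: cG.
  have [Ea fa _] : P (H n) (eta n.+1) (a n.+1).
    exact: (xgetPex _ (Pex _ _ _ HB (eta0 _))).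
  split => //; exists (B - c n.+1 * s n.+1) => v Ev.
  by rewrite HS lerD ?HB// cG.
have Ea n : E (a n) := (st_ok n).1.1.
have fa n : f (a n) = (fine (f (a n)))%:E := fE _ (Ea n) (st_ok n).1.2.
have amin n v : E v -> (f v < +oo)%E ->
    fine (f (a n.+1)) + H n (a n.+1) <= fine (f v) + H n v + eta n.+1.
  move=> Ev fv; have [B HB] := (st_ok n).2.
  have [_ _ /(_ v Ev)] : P (H n) (eta n.+1) (a n.+1).
    exact: (xgetPex _ (Pex _ _ _ HB (eta0 _))).
  by rewrite fa (fE _ Ev fv) -!EFinD lee_fin addrA.
have astep n : mdist (a n.+1) (a n.+2) <= 3 * 2^-1 ^+ n.+1.
  have h1 := amin n.+1 _ (Ea n.+1) (st_ok n.+1).1.2.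
  have h2 := amin n _ (Ea n.+2) (st_ok n.+2).1.2.
  rewrite !HS in h1.
  have /andP[_ h3] := Gd _ _ _ (Ea n.+1) (sp n.+1) (Ea n.+1).
  have /andP[h4 _] := Gd _ _ _ (Ea n.+1) (sp n.+1) (Ea n.+2).
  rewrite mdistxx in h3.
  have h5 : eta n.+2 <= eta n.+1.
    rewrite /eta ler_pM ?(ltW (c0 _)) ?(ltW (half0 _))//.
      by rewrite /c ler_pM2l// ler_wiXn2l ?invr_ge0 ?invf_le1 ?ler1n.
    by rewrite ler_wiXn2l ?invr_ge0 ?invf_le1 ?ler1n.
  have h6 : c n.+1 * G (a n.+1) (s n.+1) (a n.+1) <= 0 by rewrite pmulr_rle0.
  have h7 : c n.+1 * G (a n.+1) (s n.+1) (a n.+2) <= c n.+1 * (2 * 2^-1 ^+ n.+1).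
    by rewrite mulrCA -/(eta n.+1); lra.
  rewrite ler_pM2l// in h7; rewrite /s in h4; lra.
have [y] : exists y : X, (fun n => a n.+1) @ \oo --> y.
  apply: (@geometric_cvg _ 3 cX) => n; rewrite (le_trans (astep _))// ler_pM2l//.
  by rewrite ler_wiXn2l ?invr_ge0 ?invf_le1 ?ler1n.
move=> ay; have Ey : E y.
  have hE : \forall n \near \oo, E (a n.+1) by apply: nearW => n; exact: Ea.
  exact: (closed_cvg E clE hE y ay).
(* tau (2^-N - 2^-(N + k)) is the sum of the weights c j for N < j <= N + k *)
have tailL N k v w : E v -> E w ->
    `|(H (N + k)%N v - H N v) - (H (N + k)%N w - H N w)| <=
    tau * (2^-1 ^+ N - 2^-1 ^+ (N + k)) * mdist v w.
  move=> Ev Ew; elim: k => [|k IH].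
    by rewrite addn0 !subrr mulr0 mul0r normr0.
  rewrite addnS !HS.
  have cGL : `|c (N + k).+1 * G (a (N + k).+1) (s (N + k).+1) v -
      c (N + k).+1 * G (a (N + k).+1) (s (N + k).+1) w| <=
      tau * 2^-1 ^+ (N + k).+1 * mdist v w.
    by rewrite -mulrBr normrM gtr0_norm// ler_pM2l// GL.
  have -> : forall p q r p' q' r' : R, (p + q - r) - (p' + q' - r') =
      ((p - r) - (p' - r')) + (q - q') by move=> *; ring.
  rewrite (le_trans (ler_normD _ _))// (le_trans (lerD IH cGL))//.
  by rewrite exprS le_eqVlt; apply/orP; left; apply/eqP; field.
have tailL' N n v w : (N <= n)%N -> E v -> E w ->
    `|(H n v - H N v) - (H n w - H N w)| <= tau * 2^-1 ^+ N * mdist v w.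
  move=> Nn Ev Ew; have := tailL N (n - N)%N v w Ev Ew; rewrite subnKC//.
  move=> /le_trans; apply; rewrite ler_wpM2r ?mdist_ge0// ler_pM2l// gerBl.
  exact: ltW.
have HL N v w : E v -> E w -> `|H N v - H N w| <= (kappa + tau) * mdist v w.
  move=> Ev Ew; have := tailL' 0%N N v w (leq0n _) Ev Ew.
  have H0 : `|H 0%N v - H 0%N w| <= kappa * mdist v w.
    by rewrite /H /= -mulrBr normrM gtr0_norm// ler_pM2l// GL.
  rewrite expr0 mulr1 mulrDl.
  have -> : H N v - H N w = (H N v - H 0%N v - (H N w - H 0%N w)) +
    (H 0%N v - H 0%N w) by ring.
  by have := ler_normD (H N v - H 0%N v - (H N w - H 0%N w)) (H 0%N v - H 0%N w); lra.
have HE N v : \sum_(k < N.+1) c k * G (a k) (s k) v = H N v.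
  elim: N => [|N IH]; first by rewrite big_ord_recl big_ord0 addr0.
  by rewrite big_ord_recr /= IH.
exists y, a, s; split => // N v Ev.
rewrite !HE; have [fv|] := ltP (f v) +oo%E; last first.
  by rewrite leye_eq => /eqP ->; rewrite addye// leey.
rewrite (fE _ Ev fv) -EFinD -leeBrDr// -EFinB.
apply: (lsc_limit_le lf ay) => e e0.
pose L := kappa + 2 * tau.
have L0 : 0 < L by rewrite /L; lra.
have near1 : \forall n \near \oo, mdist y (a n.+1) < e / (2 * L).
  by apply: (metricType_numDomainType.cvgr_dist_lt ay); rewrite divr_gt0// mulr_gt0.
have near2 : \forall n \near \oo, tau * 2^-1 ^+ n < e / 2.
  by apply: cvgr_lt (half_pow_cvg _) _ _; lra.
near=> n; rewrite fa lee_fin.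
have Nn : (N <= n)%N by near: n; exact: nbhs_infty_ge.
have h1 : mdist y (a n.+1) < e / (2 * L) by near: n.
have h2 : tau * 2^-1 ^+ n < e / 2 by near: n.
have h3 : eta n.+1 <= tau * 2^-1 ^+ n.
  rewrite /eta /c -mulrA ler_pM2l// -exprD.
  by rewrite ler_wiXn2l ?invr_ge0 ?invf_le1 ?ler1n// ltnW// ltn_addr.
have h4 := amin n _ Ev fv.
have h5 := le_trans (ler_norm _) (tailL' N n _ _ Nn Ev (Ea n.+1)).
have h6 := le_trans (ler_norm _) (HL N _ _ Ey (Ea n.+1)).
have h7 := metric_triangle v y (a n.+1).
have h8 : tau * 2^-1 ^+ N * mdist v (a n.+1) <=
    tau * 2^-1 ^+ N * mdist v y + tau * mdist y (a n.+1).
  apply: (@le_trans _ _ (tau * 2^-1 ^+ N * (mdist v y + mdist y (a n.+1)))).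
    by rewrite ler_pM2l// mulr_gt0.
  rewrite mulrDr lerD2l ler_wpM2r ?mdist_ge0// ger_pMr//.
  by rewrite exprn_ile1// ?invr_ge0// invf_le1// ler1n.
have h9 : L * mdist y (a n.+1) < e / 2.
  by move: h1; rewrite invfM mulrA mulrC -ltr_pdivlMl ?invr_gt0// invrK.
rewrite /L in h9; rewrite -/(H N) in h4 *; lra.
Unshelve. all: by end_near. Qed.

End variational_principle.

Section ekeland.
Context (R : realType) (X : metricType R).

(** The weight kappa of the first penalty bounds the distance to x0; the tail
    tau is lost in this bound and added to the slope. *)
Lemma ekeland (f : X -> \bar R) x0 (m kappa tau : R) :
  complete_metric X -> lower_semicontinuous f ->
  (forall v, (m%:E <= f v)%E) -> (f x0 < +oo)%E -> 0 < tau < kappa ->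
  exists u, (f u + ((kappa - tau) * mdist u x0)%:E <= f x0)%E /\
    forall v, (f u <= f v + ((kappa + tau) * mdist v u)%:E)%E.
Proof.
move=> cX lf fm fx0 /andP[tau0 kap0].
have [||y [a [s [_ a0 _ _ /(_ 0%N) ymin]]]] := @variational_principle R X setT f
  (fun a _ y => mdist a y) x0 1 kappa tau m cX closedT lf (fun v _ => fm v) I fx0
  ltr01 (lt_trans tau0 kap0) tau0.
- by move=> b s y _ s0 _; rewrite lexx gerBl ltW.
- move=> b _ y z _ _ _ _; rewrite ler_norml lerBlDl lerBrDl.
  have := metric_triangle b y z; have := metric_triangle b z y.
  by rewrite (metric_sym z y); lra.
have {}ymin v : (f y + (kappa * mdist x0 y)%:E <=
    f v + (kappa * mdist x0 v + tau * mdist v y)%:E)%E.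
  by have := ymin v Logic.I; rewrite !big_ord_recl !big_ord0 !addr0 a0 expr0 mulr1.
have fN v : f v != -oo%E by rewrite gt_eqF// (lt_le_trans _ (fm v))// ltNyr.
have := ymin x0; rewrite mdistxx mulr0 add0r.
case fx0E : (f x0) fx0 => [q| |] // _; last by have := fN x0; rewrite fx0E.
case fyE : (f y) => [r| |] // h; last by have := fN y; rewrite fyE.
exists y; rewrite fyE; split => [|v].
  by move: h; rewrite !lee_fin (metric_sym y x0); lra.
have := ymin v; rewrite fyE; case fvE : (f v) => [p| |]; last 2 first.
- by move=> _; rewrite addye// leey.
- by have := fN v; rewrite fvE.
rewrite !lee_fin => h1.
have : kappa * mdist x0 v <= kappa * (mdist x0 y + mdist y v).
  by rewrite ler_pM2l; [exact: metric_triangle|lra].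
rewrite (metric_sym y v); lra.
Qed.

End ekeland.

(** * Increasing functions of class C1 *)

Section class_C1_theory.
Context (R : realType) (phi : R -> R).
Hypothesis hphi : class_C1 phi.
Implicit Types (a k r s t : R) (y : \bar R).
Local Notation phi' := (phi^`()%classic).

Lemma class_C1_at0 : phi 0 = 0. Proof. by case: hphi => -[]. Qed.

Lemma class_C1_gt0 t : 0 < t -> 0 < phi t. Proof. by case: hphi => -[_ + _ _ _]; exact. Qed.

Lemma class_C1_ge0 t : 0 <= t -> 0 <= phi t.
Proof. by rewrite le_eqVlt => /predU1P[<-|/class_C1_gt0/ltW//]; rewrite class_C1_at0. Qed.

Lemma class_C1_derive_gt0 t : 0 < t -> 0 < phi' t.
Proof. by case: hphi => _ _ _ /(_ t) h /h[]. Qed.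

Lemma class_C1_is_derive t : 0 < t -> is_derive t 1 phi (phi' t).
Proof.
case: hphi => _ _ _ /(_ t) h /h[dphi _ _].
by rewrite derive1E; exact/derivableP.
Qed.

Lemma class_C1_continuous t : 0 < t -> {for t, continuous phi}.
Proof.
case: hphi => _ _ _ /(_ t) h /h[dphi _ _].
by apply: differentiable_continuous; exact/derivable1_diffP.
Qed.

Lemma class_C1_MVT s t : 0 <= s -> s < t ->
  exists c, [/\ s < c, c < t & phi t - phi s = phi' c * (t - s)].
Proof.
move=> s0 st.
have [c||] := @MVT R phi phi' s t st.
- by rewrite in_itv /= => /andP[sc _]; apply: class_C1_is_derive; exact: le_lt_trans sc.
- apply/continuous_within_itvP => //; split.
  + move=> c; rewrite in_itv /= => /andP[sc _]; apply: class_C1_continuous.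
    exact: le_lt_trans sc.
  + move: s0; rewrite le_eqVlt => /predU1P[<-|s0]; first by case: hphi.
    by apply: cvg_at_right_filter; exact: class_C1_continuous.
  + by apply: cvg_at_left_filter; apply: class_C1_continuous; exact: le_lt_trans st.
- by move=> c; rewrite in_itv /= => /andP[sc ct] e; exists c.
Qed.

Lemma class_C1_lt s t : 0 <= s -> s < t -> phi s < phi t.
Proof.
move=> s0 st; have [c [sc ct e]] := class_C1_MVT s0 st.
have := class_C1_derive_gt0 (le_lt_trans s0 sc); nra.
Qed.

Lemma class_C1_le s t : 0 <= s -> s <= t -> phi s <= phi t.
Proof. by move=> s0; rewrite le_eqVlt => /predU1P[->//|/(class_C1_lt s0)/ltW]. Qed.

(** phi' is continuous at a, so the mean value theorem gives slopes above k on the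
    left of a. *)
Lemma class_C1_local_slope a k : 0 < a -> k < phi' a -> exists2 r, 0 < r < a &
  forall s, a - r < s -> s <= a -> k * (a - s) <= phi a - phi s.
Proof.
move=> a0 ka.
have [_ /(cvgr_gt (phi' a))/(_ _ ka) near_k _] : [/\ derivable phi a 1,
  {for a, continuous phi'} & 0 < phi' a] by case: hphi => _ _ _ /(_ a a0).
have [d /= d0 hd] := near_k.
exists (Num.min d (a / 2)).
  by rewrite lt_min d0 gt_min/=; apply/andP; split; [lra | apply/orP; right; lra].
move=> s sa; rewrite le_eqVlt => /predU1P[->|s_a]; first by rewrite !subrr mulr0.
have [sd s0] : a - d < s /\ 0 < s.
  have : Num.min d (a / 2) <= d by rewrite ge_min lexx.
  have : Num.min d (a / 2) <= a / 2 by rewrite ge_min lexx orbT.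
  by lra.
have [c [sc ca ->]] := class_C1_MVT (ltW s0) s_a.
rewrite ler_pM2r ?subr_gt0// ltW//; apply: hd => /=.
by rewrite gtr0_norm ?subr_gt0//; lra.
Qed.

Lemma extend_fin r : 0 <= r -> extend phi r%:E = (phi r)%:E.
Proof. by move=> r0; rewrite /extend ltNge r0. Qed.

Lemma extend_ge0 y : (0 <= extend phi y)%E.
Proof.
case: y => [r| |] //=; have [//|r0] := ltP r 0.
by rewrite lee_fin class_C1_ge0.
Qed.

Lemma extend_le0 y : (y <= 0)%E -> extend phi y = 0%E.
Proof.
case: y => [r| |] //=; rewrite lee_fin le_eqVlt => /predU1P[->|->//].
by rewrite ltxx class_C1_at0.
Qed.

Lemma extend_homo (x y : \bar R) : (x <= y)%E -> (extend phi x <= extend phi y)%E.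
Proof.
move: x y => [r| |] [s| |]//; rewrite ?leey//; last first.
  by move=> _; rewrite extend_ge0.
rewrite lee_fin => rs /=.
have [r0|r0] := ltP r 0; first by have := extend_ge0 s%:E.
by rewrite ltNge (le_trans r0 rs)/= lee_fin class_C1_le.
Qed.

Lemma extend_lsc (X : topologicalType) (f : X -> \bar R) :
  lower_semicontinuous f -> lower_semicontinuous (extend phi \o f).
Proof.
move=> lf u a /= au.
have [a0|a0] := ltP a 0.
  exists setT; first exact: filterT.
  by move=> v _; rewrite (lt_le_trans _ (extend_ge0 _)).
have [t [t0 tu at_]] : exists t, [/\ 0 <= t, (t%:E < f u)%E & a < phi t].
  have a0E : (a%:E < 0)%E = false by rewrite lte_fin ltNge a0.
  move: au; case: (f u) => [r|_|]; last by rewrite [extend _ _]/= a0E.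
    rewrite [extend _ _]/=; have [_|r0] := ltP r 0; first by rewrite a0E.
    rewrite lte_fin => ar; have {}r0 : 0 < r.
      by rewrite lt_neqAle r0 andbT; apply/eqP => r0'; move: ar;
        rewrite -r0' class_C1_at0 ltNge a0.
    have [d /= d0 hd] := cvgr_gt _ (class_C1_continuous r0) _ ar.
    have d1 : Num.min d r <= d by rewrite ge_min lexx.
    have d2 : Num.min d r <= r by rewrite ge_min lexx orbT.
    have d3 : 0 < Num.min d r by rewrite lt_min d0.
    exists (r - Num.min d r / 2); split; rewrite ?lte_fin; [lra|lra|].
    by apply: hd; rewrite /= opprB addrC subrK gtr0_norm; lra.
  case: hphi => _ /cvgryPgt/(_ a) phiy _ _.
  have [t [at_ t0]] := @filter_ex _ (+oo%R : set_system R) _ _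
    (filterI phiy (nbhs_pinfty_ge (num_real 0))).
  by exists t; rewrite ltry.
have [U nU hU] := lf _ _ tu; exists U => // v /hU tv.
by rewrite (lt_le_trans _ (extend_homo (ltW tv)))// extend_fin// lte_fin.
Qed.

End class_C1_theory.

(** * Failure of the error bound *)

Section distance.
Context (R : realType) (X : metricType R).
Implicit Types (x u v : X) (A : set X).

Lemma dist_to_le x v A : A v -> (dist_to x A <= (mdist x v)%:E)%E.
Proof. by move=> Av; apply: ereal_inf_lbound; exists v. Qed.

Lemma dist_to_lt x A y : (dist_to x A < y)%E ->
  exists2 v, A v & ((mdist x v)%:E < y)%E.
Proof. by move=> /ereal_inf_lt[_ [v Av <-] vy]; exists v. Qed.

Lemma dist_to_triangle x u A :
  (dist_to x A <= dist_to u A + (mdist x u)%:E)%E.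
Proof.
rewrite -leeBlDr//; apply: le_ereal_inf_tmp => _ [v Av <-].
rewrite leeBlDr// (le_trans (dist_to_le _ Av))// -EFinD lee_fin addrC.
exact: metric_triangle.
Qed.

End distance.

Section failure.
Context (R : realType) (phi : R -> R) (hphi : class_C1 phi).
Context (X : metricType R) (f : X -> \bar R).

Definition far_strip (xbar : X) (delta mu : \bar R) (alpha : R) : set X :=
  [set u | (eball xbar delta `&` strip f mu) u /\
    ((Num.max alpha (1 - alpha)%R)%:E * extend phi (f u)
      < dist_to u (sublevel0 f))%E].

Lemma strip_fin mu u : strip f mu u -> exists2 a : R, 0 < a & f u = a%:E.
Proof.
case/andP => + /lt_le_trans/(_ (leey _)); case: (f u) => [r| |]//.
by rewrite lte_fin => r0 _; exists r.
Qed.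

(** The point is given by Ekeland's principle for phi o f at a point x violating
    the error bound: with phi (f x) < la < d(x, S), the constant
    k1 = phi (f x) / (alpha la) is below 1 / alpha and
    phi (f u) + k1 d(u, x) <= phi (f x), so that d(u, x) <= alpha la. *)
Lemma error_bound_failure xbar delta mu (alpha : R) :
  complete_metric X -> lower_semicontinuous f -> 0 < alpha <= 1 ->
  (0 < delta)%E -> sublevel0 f xbar \/ delta = +oo%E ->
  ~ error_bound phi f xbar (delta * ((1 + alpha)^-1)%:E) mu ->
  exists u (k : R), [/\ far_strip xbar delta mu alpha u, 0 < k, alpha * k < 1 &
    forall v, (extend phi (f u) <= extend phi (f v) + (k * mdist v u)%:E)%E].
Proof.
move=> cX lf /andP[al0 al1] de0 xde neb.
pose S := sublevel0 f; pose de' := (delta * ((1 + alpha)^-1)%:E)%E.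
have [x [[xde' xstrip] gxD]] : exists x, (eball xbar de' `&` strip f mu) x /\
    (extend phi (f x) < dist_to x S)%E.
  apply: contrapT => h; apply: neb; split; last first.
    case: xde => [?|->]; [by left|right].
    by rewrite gt0_mulye// lte_fin invr_gt0; lra.
  move=> x hx; rewrite leNgt; apply/negP => gxD; apply: h; by exists x.
have [a a0 fxE] := strip_fin xstrip.
pose p := phi a; have p0 : 0 < p by exact: class_C1_gt0.
have gxE : extend phi (f x) = p%:E by rewrite fxE extend_fin// ltW.
have [la pla laD] : exists2 la : R, p < la & (la%:E < dist_to x S)%E.
  move: gxD; rewrite gxE; case: (dist_to x S) => [D| |]//.
    by rewrite lte_fin => pD; exists ((p + D) / 2); rewrite ?lte_fin; lra.
  by exists (p + 1); rewrite ?ltry//; lra.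
have la0 : 0 < la by lra.
pose k1 := p / (alpha * la); pose k2 := (k1 + alpha^-1) / 2.
have k10 : 0 < k1 by rewrite divr_gt0// mulr_gt0.
have k1al : k1 < alpha^-1.
  rewrite /k1 invfM mulrCA gtr_pMr ?invr_gt0//.
  by rewrite ltr_pdivrMr// mul1r.
have [] := @ekeland R X (extend phi \o f) x 0 ((k1 + k2) / 2) ((k2 - k1) / 2) cX
  (extend_lsc hphi lf).
- by move=> v; exact: extend_ge0.
- by rewrite /= gxE ltry.
- by rewrite /k2; apply/andP; split; lra.
have -> : (k1 + k2) / 2 - (k2 - k1) / 2 = k1 by lra.
have -> : (k1 + k2) / 2 + (k2 - k1) / 2 = k2 by lra.
move=> u [+ umin]; rewrite /= gxE => gu.
have [q guE] : exists q : R, extend phi (f u) = q%:E.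
  have := extend_ge0 hphi (f u); move: gu.
  by case: (extend phi (f u)) => [q| |]//; exists q.
have q0 : 0 <= q by rewrite -lee_fin -guE extend_ge0.
pose d := mdist u x; have d0 : 0 <= d by exact: mdist_ge0.
have {}gu : q + k1 * d <= p by move: gu; rewrite guE -EFinD lee_fin.
(* this is k1 d <= p - q, multiplied by alpha * la *)
have gu' : p * d <= alpha * la * (p - q).
  have : alpha * la * (k1 * d) <= alpha * la * (p - q).
    by rewrite ler_pM2l ?mulr_gt0//; lra.
  have -> // : alpha * la * (k1 * d) = p * d.
  by rewrite /k1; field; rewrite !gt_eqF.
have dla : d <= alpha * la.
  rewrite -(ler_pM2l p0) (le_trans gu')// mulrC ler_wpM2r//.
    by rewrite mulr_ge0// ltW.
  lra.
have Dd : ((la - d)%:E < dist_to u S)%E.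
  have := lt_le_trans laD (dist_to_triangle x u S).
  by rewrite EFinB lteBlDr// (metric_sym x u).
have ald : 0 <= la - d by nra.
have uS : ~ S u.
  move=> /(dist_to_le u); rewrite mdistxx => /(lt_le_trans Dd).
  by rewrite lte_fin ltNge ald.
have fu0 : (0 < f u)%E by rewrite ltNge; apply/negP.
have fua : (f u <= a%:E)%E.
  rewrite leNgt; apply/negP => afu; have : p < q; last first.
    by have := mulr_ge0 (ltW k10) d0; lra.
  move: guE; rewrite /p; move: afu; case: (f u) => [r| |]//.
  rewrite lte_fin => ar; rewrite (extend_fin _ (ltW (lt_trans a0 ar))).
  by move=> [<-]; apply: class_C1_lt => //; exact: ltW.
exists u, k2; split.
- split; [split|].
  + rewrite /eball /=; move: xde' xde; rewrite /eball /= /de'.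
    case: (delta) de0 => [r|_ _ _|]//; last by rewrite ltry.
    rewrite lte_fin => r0; rewrite -EFinM !lte_fin => xr -[xS|//].
    have : (la%:E < (mdist x xbar)%:E)%E by exact: lt_le_trans laD (dist_to_le _ xS).
    rewrite lte_fin (metric_sym x xbar) => lax.
    rewrite (le_lt_trans (metric_triangle _ x _))// (metric_sym x u) -/d.
    rewrite ltr_pdivlMr in xr; last by lra.
    have : alpha * la <= alpha * mdist xbar x by rewrite ler_pM2l// ltW.
    move=> h; rewrite mulrDr mulr1 mulrC in xr; apply: le_lt_trans xr.
    by rewrite lerD2l (le_trans dla).
  + rewrite /strip /= fu0 (le_lt_trans fua)// -fxE.
    by case/andP: xstrip.
  + rewrite guE -EFinM (le_lt_trans _ Dd)// lee_fin.
    rewrite maxr_pMl//; rewrite ge_max; apply/andP; split.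
    * have : la * (alpha * q) <= la * (la - d); last by rewrite ler_pM2l.
      have h1 : 0 <= (la - p) * (alpha * la - d) by rewrite mulr_ge0//; lra.
      have h2 : 0 <= la * (la * (1 - alpha)) by rewrite !mulr_ge0//; lra.
      lra.
    * have h1 : 0 <= k1 * d by rewrite mulr_ge0// ltW.
      have h2 : 0 <= (1 - alpha) * (la - q) by rewrite mulr_ge0//; lra.
      lra.
- by rewrite /k2 divr_gt0// addr_gt0// invr_gt0.
- have : alpha * k2 < alpha * alpha^-1 by rewrite ltr_pM2l// /k2; lra.
  by rewrite divff// gt_eqF.
- exact: umin.
Qed.

End failure.

(** * Dual norms, and slopes at an almost minimizer *)

Section dual_norm.
Context (R : realType) (V : normedModType R).
Implicit Types (W : set V) (g : V -> R).

Lemma dual_norm_on_bound W g (n : R) : is_subspace W ->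
  (forall (a : R) u v, W u -> W v -> g (a *: u + v) = a * g u + g v) ->
  (dual_norm_on W g <= n%:E)%E -> forall v, W v -> `|g v| <= n * `|v|.
Proof.
move=> [W0 Wlin] glin gn v Wv.
have WZ a : W (a *: v) by rewrite -[_ *: _]addr0; exact: Wlin.
have g0 : g 0 = 0 by have := glin (-1) 0 0 W0 W0; rewrite scaler0 addr0 mulN1r addNr.
have gZ a : g (a *: v) = a * g v by rewrite -[_ *: _]addr0 glin// g0 addr0.
have [->|v0] := eqVneq v 0; first by rewrite g0 !normr0 mulr0.
have nv : 0 < `|v| by rewrite normr_gt0.
have : (`|g (`|v|^-1 *: v)|%:E <= n%:E)%E.
  apply: le_trans gn; apply: ereal_sup_ubound; exists (`|v|^-1 *: v) => //.
  by split => //; rewrite normrZ normfV normr_id mulVf// gt_eqF.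
rewrite lee_fin gZ normrM normfV normr_id mulrC.
by rewrite ler_pdivrMr.
Qed.

Lemma dual_norm_on_le W g (n : R) : 0 <= n ->
  (forall v, W v -> `|g v| <= n * `|v|) -> (dual_norm_on W g <= n%:E)%E.
Proof.
move=> n0 gn; apply: ge_ereal_sup => _ [v [Wv v1] <-].
by rewrite lee_fin (le_trans (gn _ Wv))// ler_piMr.
Qed.

End dual_norm.

Section slopes.
Context (R : realType) (X : metricType R).
Implicit Types (f g : X -> \bar R) (u v : X) (a k d : R).

Lemma quotient_le a (y : \bar R) d k : y != -oo%E -> 0 < d -> 0 <= k ->
  (a%:E <= y + (k * d)%:E)%E ->
  (maxe (a%:E - y) 0 * (d^-1)%:E <= k%:E)%E.
Proof.
move=> yN d0 k0 h; rewrite lee_pdivrMr// ge_max; apply/andP; split; last first.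
  by rewrite -EFinM lee_fin mulr_ge0// ltW.
move: yN h; case: y => [r| |]// _; last by rewrite leNye.
by rewrite -EFinM -EFinD -EFinB !lee_fin; lra.
Qed.

Lemma slope_le f u a k : proper_valued f -> f u = a%:E -> 0 <= k ->
  (\forall v \near u, (f u <= f v + (k * mdist v u)%:E)%E) ->
  (slope f u <= k%:E)%E.
Proof.
move=> fN fu k0 hV.
rewrite /slope fu /= ge_max lee_fin k0 /=.
apply: ge_ereal_inf; eexists; first exists
  ([set v | (f u <= f v + (k * mdist v u)%:E)%E] `&` [set v | v != u]).
- by apply: filterI; [exact: (nbhs_dnbhs hV) | exact: withinT].
- reflexivity.
apply: ge_ereal_sup => _ [v [/= hv vu] <-].
by rewrite quotient_le// ?mdist_gt0// -fu.
Qed.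

Lemma nonlocal_slope_le f u a k : f u = a%:E -> 0 <= k ->
  (forall v, (f u <= maxe (f v) 0 + (k * mdist v u)%:E)%E) ->
  (nonlocal_slope f u <= k%:E)%E.
Proof.
move=> fu k0 h; rewrite /nonlocal_slope fu /= ge_max lee_fin k0 /=.
apply: ge_ereal_sup => _ [v /= vu <-].
rewrite quotient_le// ?mdist_gt0//; last by rewrite -fu.
by rewrite gt_eqF// (lt_le_trans (ltNyr 0))// le_max lexx orbT.
Qed.

End slopes.

Section descent.
Context (R : realType) (phi : R -> R) (hphi : class_C1 phi).
Context (X : metricType R) (f : X -> \bar R) (u : X) (a k : R).
Hypotheses (fu : f u = a%:E) (a0 : 0 < a) (k0 : 0 < k).
Hypothesis umin :
  forall v, (extend phi (f u) <= extend phi (f v) + (k * mdist v u)%:E)%E.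
Local Notation phi' := (phi^`()%classic).

Let umin_fin v r : f v = r%:E -> 0 <= r -> phi a - phi r <= k * mdist v u.
Proof.
move=> fv r0; have := umin v; rewrite fv fu (extend_fin _ r0) (extend_fin _ (ltW a0)).
by rewrite -EFinD lee_fin; lra.
Qed.

(** Near u, f does not take values much below a, and phi has slope almost phi' a
    there; the values of f above a are harmless. *)
Lemma local_descent k' : lower_semicontinuous f -> 0 < k' -> k < k' * phi' a ->
  \forall v \near u, (f u <= f v + (k' * mdist v u)%:E)%E.
Proof.
move=> lf k'0 kk'.
have [r /andP[r0 ra] hr] : exists2 r, 0 < r < a & forall s, a - r < s -> s <= a ->
    (k / k') * (a - s) <= phi a - phi s.
  by apply: class_C1_local_slope => //; rewrite ltr_pdivrMr// mulrC.
have [U nU hU] : exists2 U, nbhs u U & forall v, U v -> ((a - r)%:E < f v)%E.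
  by apply: lf; rewrite fu lte_fin; lra.
apply: filterS nU => v /hU; rewrite fu.
have d0 := mdist_ge0 v u.
case fv : (f v) => [s| |]//; last by rewrite addye// leey.
rewrite lte_fin -EFinD lee_fin => ars.
have [as_|sa] := leP a s; first by have := mulr_ge0 (ltW k'0) d0; lra.
have h := le_trans (hr s ars (ltW sa)) (umin_fin fv (ltW (lt_trans _ ars))).
rewrite mulrAC ler_pdivrMr// -mulrA ler_pM2l// in h; rewrite ?subr_gt0//; lra.
Qed.

(** By the mean value theorem, phi a - phi s = phi' c (a - s) with c < a, and
    phi' c >= phi' a. *)
Lemma nonlocal_descent : proper_valued f ->
  (forall t1 t2 : R, 0 < t1 -> t1 <= t2 -> phi' t2 <= phi' t1) ->
  forall v, (f u <= maxe (f v) 0 + (k / phi' a * mdist v u)%:E)%E.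
Proof.
move=> fN mono v; have d0 := mdist_ge0 v u; have pa := class_C1_derive_gt0 hphi a0.
have key s : 0 <= s -> phi a - phi s <= k * mdist v u ->
    a <= s + k / phi' a * mdist v u.
  move=> s0 h; have [as_|sa] := leP a s.
    by have := mulr_ge0 (divr_ge0 (ltW k0) (ltW pa)) d0; lra.
  have [c [sc ca e]] := class_C1_MVT hphi s0 sa.
  rewrite mulrAC addrC -lerBlDr ler_pdivlMr//.
  have := mono c a (le_lt_trans s0 sc) (ltW ca); rewrite e in h.
  nra.
rewrite fu; case fv : (f v) (fN v) => [s| |]// _; last first.
  by rewrite maxye addye// leey.
have [s0|s0] := leP 0 s.
  rewrite (_ : maxe s%:E 0 = s%:E); last by apply/max_idPl; rewrite lee_fin.
  by rewrite -EFinD lee_fin key// umin_fin.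
rewrite (_ : maxe s%:E 0 = 0%:E); last by apply/max_idPr; rewrite lee_fin ltW.
rewrite -EFinD lee_fin key// class_C1_at0//; have := umin v.
rewrite fv (extend_le0 hphi (_ : (s%:E <= 0)%E)); last by rewrite lee_fin ltW.
by rewrite fu (extend_fin _ (ltW a0)) add0e lee_fin subr0.
Qed.

End descent.

(** * Necessary conditions *)

Section necessity.
Context (R : realType) (phi : R -> R) (hphi : class_C1 phi).
Local Notation phi' := (phi^`()%classic).

Lemma error_bound_near (X : metricType R) (f : X -> \bar R) xbar delta mu u a :
  error_bound phi f xbar delta mu -> (eball xbar delta `&` strip f mu) u ->
  f u = a%:E -> forall e, 0 < e ->
  exists2 v, (f v <= 0)%E & mdist u v < phi a + e.
Proof.
move=> [eb _] su fu e e0.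
have a0 : 0 < a by move: su => [_ /andP[+ _]]; rewrite fu lte_fin.
have [|v Sv duv] := @dist_to_lt R X u (sublevel0 f) (phi a + e)%:E.
  rewrite (le_lt_trans (eb u su))// fu (extend_fin _ (ltW a0)).
  by rewrite lte_fin ltrDl.
by exists v => //; rewrite -lte_fin.
Qed.

Lemma error_bound_nonlocal_slope (X : metricType R) (f : X -> \bar R)
    xbar delta mu u :
  error_bound phi f xbar delta mu -> (eball xbar delta `&` strip f mu) u ->
  (1 <= nonlocal_slope (extend phi \o f) u)%E.
Proof.
move=> eb su; have [a a0 fu] := strip_fin su.2.
have pa0 := class_C1_gt0 hphi a0.
have gu : extend phi (f u) = (phi a)%:E by rewrite fu extend_fin// ltW.
rewrite /nonlocal_slope /= gu /= le_max; apply/orP; right.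
apply/lee_addgt0Pr => e e0.
have [v fv duv] := error_bound_near eb su fu (mulr_gt0 e0 pa0).
have uv : v != u.
  by apply/eqP => vu; move: fv; rewrite vu fu lee_fin leNgt a0.
have d0 : 0 < mdist v u by rewrite mdist_gt0.
rewrite -leeBlDr//; apply: le_ereal_sup_tmp; eexists; first by exists v.
rewrite extend_le0// maxxx sube0 -EFinB.
rewrite (_ : maxe _ _ = (phi a)%:E); last by apply/max_idPl; rewrite lee_fin ltW.
rewrite -EFinM lee_fin ler_pdivlMr// (metric_sym v u).
rewrite (metric_sym v u) in d0; nra.
Qed.

Lemma class_C1_ratio_le_derive (a : R) : 0 < a ->
  (forall t1 t2 : R, 0 < t1 -> t1 <= t2 -> phi' t1 <= phi' t2) \/
  convex_function (`[0%R, +oo[%classic : set (convex_lmodType R^o))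
    (phi : convex_lmodType R^o -> R^o) ->
  phi a / a <= phi' a.
Proof.
move=> a0 [mono|cvx].
  have [c [c0 ca e]] := class_C1_MVT hphi (lexx 0) a0.
  rewrite class_C1_at0// !subr0 in e.
  by rewrite ler_pdivrMr// e ler_pM2r// mono// ltW.
rewrite leNgt; apply/negP => h.
have [_ /(cvgr_lt (phi' a))/(_ _ h) near_a _] : [/\ derivable phi a 1,
  {for a, continuous phi'} & 0 < phi' a] by case: hphi => _ _ _ /(_ a a0).
have [d /= d0 hd] := near_a.
pose s := a - Num.min d a / 2.
have m0 : 0 < Num.min d a by rewrite lt_min d0.
have md : Num.min d a <= d by rewrite ge_min lexx.
have ma : Num.min d a <= a by rewrite ge_min lexx orbT.
have s0 : 0 < s by rewrite /s; lra.
have sa : s < a by rewrite /s; lra.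
have [c [sc ca e]] := class_C1_MVT hphi (ltW s0) sa.
have {}hd : phi' c < phi a / a.
  apply: hd => /=; rewrite gtr0_norm ?subr_gt0//.
  by move: sc; rewrite /s; lra.
(* s is the convex combination of a and 0 with weight s / a *)
have t0 : 0 <= s / a by rewrite divr_ge0// ltW.
have t1 : s / a <= 1 by rewrite ler_pdivrMr// mul1r ltW.
have := cvx (Itv01 t0 t1) a 0; rewrite !inE /= !in_itv /= lexx (ltW a0).
move=> /(_ isT isT). rewrite !convRE /= (class_C1_at0 hphi) mulr0 addr0.
have -> : conv (Itv01 t0 t1) (a : convex_lmodType R^o) 0 = s.
  change (s / a * a + (1 - s / a) * 0 = s).
  by rewrite mulr0 addr0 divfK// gt_eqF.
have : phi' c * (a - s) < phi a / a * (a - s) by rewrite ltr_pM2r// subr_gt0.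
have -> : phi a / a * (a - s) = phi a - s / a * phi a by field; rewrite gt_eqF.
lra.
Qed.

Section convex.
Context (V : normedModType R) (f : V -> \bar R) (xbar u : V) (delta mu : \bar R).

(** A subgradient xs at u satisfies f u <= |xs| |u - v| for every v in the sublevel
    set, and such points v exist at distance almost phi (f u) from u. *)
Lemma error_bound_subdiff_slope :
  @error_bound R (normed_metric V) phi f xbar delta mu ->
  (@eball R (normed_metric V) xbar delta `&` @strip R (normed_metric V) f mu) u ->
  ((fine (f u) / phi (fine (f u)))%:E <= subdiff_slope (subdiff f) u)%E.
Proof.
move=> eb su; have [a a0 fu] := @strip_fin R (normed_metric V) f mu u su.2.
have pa0 := class_C1_gt0 hphi a0; rewrite fu /=.
apply: le_ereal_inf_tmp => _ [xs [_ [xslin _] xsub] <-].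
have nxs0 : (0 <= dual_norm xs)%E.
  apply: (@le_trans _ _ `|xs 0|%:E); first by rewrite lee_fin.
  apply: ereal_sup_ubound; exists 0 => //=; split => //.
  by rewrite normr0 ler01.
case nxsE : (dual_norm xs) nxs0 => [n| |] //; last by move=> _; rewrite leey.
rewrite !lee_fin => n0.
have xsle v : `|xs v| <= n * `|v|.
  apply: (@dual_norm_on_bound R V setT xs n) => //.
  by have := lexx (dual_norm xs); rewrite {2}nxsE.
rewrite ler_pdivrMr//; apply/ler_addgt0Pr => e e0.
have e1 : 0 < e / (1 + n) by rewrite divr_gt0//; lra.
have [v fv duv] := @error_bound_near (normed_metric V) f xbar delta mu u a eb su fu _ e1.
have {}duv : `|v - u| < phi a + e / (1 + n) by [].
have := xsub v; rewrite fu.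
have h1 := le_trans (ler_norm _) (xsle (u - v)).
have xsN : xs (v - u) = - xs (u - v).
  have := xslin (-1) (u - v) 0 I I; rewrite scaleN1r opprB addr0 mulN1r => ->.
  by have := xslin (-1) 0 0 I I; rewrite scaler0 addr0 mulN1r addNr => ->; rewrite addr0.
rewrite distrC in h1.
have h2 : n * `|v - u| <= n * phi a + e.
  rewrite (le_trans (ler_wpM2l n0 (ltW duv)))// mulrDr lerD2l mulrA.
  by rewrite ler_pdivrMr; lra.
case: (f v) fv => [r| |] //.
by rewrite !lee_fin xsN; lra.
Qed.

End convex.

End necessity.

(** * The Clarke subdifferential *)

Section bounded_dual.
Context (R : realType) (V : normedModType R).

Lemma bounded_dual_on (W : set V) (g : V -> R) (n : R) : is_subspace W ->
  (forall (a : R) u v, W u -> W v -> g (a *: u + v) = a * g u + g v) ->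
  0 <= n -> (forall v, W v -> `|g v| <= n * `|v|) -> dual_on W g.
Proof.
move=> [W0 Wlin] glin n0 gn; split => //.
apply/subspace_continuousP => x Wx.
apply/cvgrPdist_lt => e e0; rewrite near_withinE.
have d0 : 0 < e / (1 + n) by rewrite divr_gt0//; lra.
apply/nbhs_ballP; exists (e / (1 + n)) => //= v; rewrite -ball_normE /= => xv Wv.
have Wvx : W (-1 *: v + x) by exact: Wlin.
have -> : g x - g v = g (-1 *: v + x) by rewrite glin// mulN1r addrC.
rewrite (le_lt_trans (gn _ Wvx))// scaleN1r addrC.
rewrite ltr_pdivlMr in xv; last by lra.
have := normr_ge0 (x - v); lra.
Qed.

End bounded_dual.

Section clarke.
Context (R : realType) (V : normedModType R) (f : V -> \bar R) (x : V) (a : R).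
Hypotheses (fN : forall v, f v != -oo%E) (fx : f x = a%:E).

(** The epigraph of clarke_dd f x, where the upper limit over t > 0 and over the
    points of the epigraph of f near (x, f x) is unfolded. *)
Definition clarke_epi (z : V) (r : R) : Prop :=
  forall eps e : R, 0 < eps -> 0 < e -> exists2 d : R, 0 < d & forall u (b t : R),
    `|u - x| < d -> `|b - a| < d -> 0 < t < d -> (f u <= b%:E)%E ->
    exists2 z', `|z' - z| < eps & (f (u + t *: z')%R <= (b + t * (r + e))%:E)%E.

Lemma clarke_epiP z r : (clarke_dd f x z <= r%:E)%E -> clarke_epi z r.
Proof.
move=> ddr eps e eps0 e0.
pose L eps := limf_esup (fun p : V * R * R => let: (u, a, t) := p in
       ereal_inf [set (f (u + t *: z')%R - a%:E) * (t^-1)%:E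
                 | z' in [set z' | (`|z' - z| < eps)%R]])%E
    (filter_prod
       (within [set ua : V * R | (f ua.1 <= ua.2%:E)%E] (nbhs (x, fine (f x))))
       (0%R : R)^'+).
have Lmono : {in Interval (BRight 0) (BInfty R false) &, nonincreasing_fun L}.
  move=> s t _ _ st; apply: le_ereal_inf_tmp => _ [U FU <-].
  apply: ge_ereal_inf; eexists; first by exists U.
  apply: ge_ereal_sup => _ [[[u b] h] Up <-].
  apply: le_ereal_sup_tmp; eexists; first by exists (u, b, h).
  by apply: ereal_inf_le_tmp => _ [z' /= z't <-]; exists z' => //; exact: lt_le_trans z't st.
have : (L eps <= r%:E)%E.
  apply: le_trans ddr; rewrite /clarke_dd -/L.
  have -> : lim (L eps @[eps --> (0:R)^'+]) =
      ereal_sup (L @` [set` Interval (BRight 0) (BInfty R false)]).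
    by apply: cvg_lim => //; exact: nonincreasing_at_right_cvge.
  by apply: ereal_sup_ubound; exists eps => //=; rewrite in_itv /= eps0.
move=> Lr; have : (L eps < (r + e)%:E)%E.
  by rewrite (le_lt_trans Lr)// lte_fin; lra.
move=> /ereal_inf_lt[_ [U [[P Q] /= [FP GQ] PQU] <-] supU].
move: FP; rewrite fx /= => -[[A B] /= [nA nB] ABP].
have /nbhs_ballP[d1 /= d10 hd1] := nA; have [d2 /= d20 hd2] := nB; have [d3 /= d30 hd3] := GQ.
exists (Num.min d1 (Num.min d2 d3)); first by rewrite !lt_min d10 d20.
move=> u b t; rewrite !lt_min => /and3P[ud _ _] /and3P[_ bd _] /andP[t0 /and3P[_ _ td]] fub.
have : (ereal_inf [set (f (u + t *: z')%R - b%:E) * (t^-1)%:E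
                 | z' in [set z' | (`|z' - z| < eps)%R]] < (r + e)%:E)%E.
  apply: le_lt_trans supU; apply: ereal_sup_ubound; exists (u, b, t) => //.
  apply: PQU; split => /=.
    apply: (ABP (u, b)) => //; split => /=.
      by apply: hd1; rewrite -ball_normE /= distrC.
    by apply: hd2; rewrite /= distrC.
  by apply: hd3 => //=; rewrite sub0r normrN gtr0_norm.
move=> /ereal_inf_lt[_ [z' /= z'z <-]].
case fv : (f (u + t *: z')) (fN (u + t *: z')) => [q| |]// _; last first.
  by rewrite addye// gt0_mulye ?lte_fin ?invr_gt0.
rewrite -EFinB -EFinM lte_fin ltr_pdivrMr// => h.
by exists z' => //; rewrite fv lee_fin; lra.
Qed.

Lemma clarke_epi0 : clarke_epi 0 0.
Proof.
move=> eps e eps0 e0; exists 1 => // u b t _ _ /andP[t0 _] fub.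
exists 0; first by rewrite subrr normr0.
rewrite scaler0 addr0 (le_trans fub)// lee_fin add0r lerDl.
by rewrite mulr_ge0// ltW.
Qed.

(** Rockafellar's argument for the convexity of the Clarke tangent cone: the
    points near x of the epigraph moved along z1 stay in the epigraph near x,
    so that they can be moved along z2. *)
Lemma clarke_epiD z1 r1 z2 r2 :
  clarke_epi z1 r1 -> clarke_epi z2 r2 -> clarke_epi (z1 + z2) (r1 + r2).
Proof.
move=> C1 C2 eps e eps0 e0.
have eps2 : 0 < eps / 2 by lra.
have e2 : 0 < e / 2 by lra.
have [d1 d10 h1] := C1 _ _ eps2 e2; have [d2 d20 h2] := C2 _ _ eps2 e2.
pose M := 1 + `|z1| + eps + `|r1| + e.
have M1 : 1 <= M.
  by rewrite /M; have := normr_ge0 z1; have := normr_ge0 r1; lra.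
pose d := Num.min d1 (d2 / 2 / M).
have d2M : 0 < d2 / 2 / M by rewrite divr_gt0//; lra.
have dd1 : d <= d1 by rewrite ge_min lexx.
have dd2 : d <= d2 / 2 / M by rewrite ge_min lexx orbT.
have dM : d * M <= d2 / 2 by rewrite -ler_pdivlMr//; lra.
have d0 : 0 < d by rewrite lt_min d10.
have dd2' : d <= d2 / 2 by rewrite (le_trans _ dM)// ler_peMr// ltW.
exists d => // u b t ud bd /andP[t0 td] fub.
have tM : t * M < d2 / 2 by rewrite (lt_le_trans _ dM)// ltr_pM2r//; lra.
have td1 : 0 < t < d1 by rewrite t0 (lt_le_trans td).
have [z1' z1'z fz1] := h1 u b t (lt_le_trans ud dd1) (lt_le_trans bd dd1) td1 fub.
have nz1' : `|z1'| <= `|z1| + eps.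
  rewrite -[z1'](subrK z1) addrC (le_trans (ler_normD _ _))// lerD2l; lra.
have [||| |z2' z2'z fz2] := h2 (u + t *: z1') (b + t * (r1 + e / 2)) t => //.
- rewrite addrAC (le_lt_trans (ler_normD _ _))// normrZ gtr0_norm//.
  have : t * `|z1'| <= t * M.
    by rewrite ler_pM2l// /M; have := normr_ge0 r1; lra.
  lra.
- rewrite addrAC (le_lt_trans (ler_normD _ _))// normrM gtr0_norm//.
  have : t * `|r1 + e / 2| <= t * M.
    rewrite ler_pM2l// /M (le_trans (ler_normD _ _))// (gtr0_norm e2).
    by have := normr_ge0 z1; lra.
  lra.
- by rewrite t0 (lt_le_trans td)//; lra.
exists (z1' + z2').
  rewrite opprD addrACA (le_lt_trans (ler_normD _ _))//; lra.
rewrite scalerDr addrA (le_trans fz2)// lee_fin; lra.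
Qed.

Lemma clarke_epi_lower c z r : 0 <= c ->
  (\forall v \near x, (f x <= f v + (c * `|v - x|)%:E)%E) ->
  clarke_epi z r -> - (c * `|z|) <= r.
Proof.
move=> c0 /nbhs_ballP[d /= d0 hd] Cz; apply/ler_addgt0Pr => e e0.
have e2 : 0 < e / 2 by lra.
have eps0 : 0 < e / 2 / (1 + c) by rewrite divr_gt0//; lra.
have ceps : c * (e / 2 / (1 + c)) <= e / 2.
  by rewrite mulrA ler_pdivrMr; nra.
have [d1 d10 h1] := Cz _ _ eps0 e2.
pose M := 1 + `|z| + e / 2 / (1 + c).
have M0 : 0 < M by rewrite /M; have := normr_ge0 z; lra.
pose t := Num.min d1 (d / M) / 2.
have m0 : 0 < Num.min d1 (d / M) by rewrite lt_min d10 divr_gt0.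
have t0 : 0 < t by rewrite /t; lra.
have td1 : t < d1.
  have : Num.min d1 (d / M) <= d1 by rewrite ge_min lexx.
  by rewrite /t; lra.
have tdM : t * M < d.
  rewrite -ltr_pdivlMr//.
  have : Num.min d1 (d / M) <= d / M by rewrite ge_min lexx orbT.
  by rewrite /t; lra.
have [||| |z' z'z fz'] := h1 x a t; rewrite ?subrr ?normr0 ?fx ?t0//.
have nz' : `|z'| <= `|z| + e / 2 / (1 + c).
  rewrite -[z'](subrK z) addrC (le_trans (ler_normD _ _))// lerD2l; lra.
have := hd (x + t *: z'); rewrite /= -ball_normE /= opprD addrA subrr sub0r normrN.
rewrite normrZ gtr0_norm// [x + _ - x]addrAC subrr add0r normrZ gtr0_norm//.
have -> : t * `|z'| < d.
  by rewrite (le_lt_trans _ tdM)// ler_pM2l// /M; lra.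
move=> /(_ isT); case fv : (f (x + t *: z')) fz' => [q| |] //; rewrite fx; last first.
  by have := fN (x + t *: z'); rewrite fv.
rewrite -EFinD !lee_fin => h2 h3.
have : t * (- (c * `|z'|)) <= t * (r + e / 2) by nra.
rewrite ler_pM2l// => h4.
have := ler_wpM2l c0 nz'; rewrite mulrDr; lra.
Qed.

(** At a local minimizer of f + c |. - x|, clarke_dd f x is at least - c |.|, and
    a linear functional separates the two sublinear functionals. *)
Lemma clarke_subdiff_slope_le c : 0 <= c ->
  (\forall v \near x, (f x <= f v + (c * `|v - x|)%:E)%E) ->
  (subdiff_slope (clarke_subdiff f) x <= c%:E)%E.
Proof.
move=> c0 xmin.
have [g [glin gc gC]] := sandwich c0 clarke_epi0 clarke_epiD
  (fun z r => @clarke_epi_lower c z r c0 xmin).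
apply: ge_ereal_inf; exists (dual_norm g); last exact: dual_norm_on_le.
exists g => //; split.
- by rewrite fx ltry.
- exact: (@bounded_dual_on _ _ setT g c).
- move=> z; case ddz : (clarke_dd f x z) => [r| |]; last 2 first.
  + by rewrite leey.
  + have C : clarke_epi z (g z - 1) by apply: clarke_epiP; rewrite ddz leNye.
    by exfalso; have := gC _ _ C; lra.
  + by rewrite lee_fin; apply: gC; apply: clarke_epiP; rewrite ddz.
Qed.

End clarke.

(** * Smooth approximation of the norm *)

Lemma closed_preimage_continuous (T U : topologicalType) (f : T -> U) (D : set U) :
  continuous f -> closed D -> closed (f @^-1` D).
Proof. by move=> cf; apply: preimage_closed => x _; exact: cf. Qed.

(** As an infimum of continuous functions, J is upper semicontinuous on K. *)
Lemma compact_usc_max (R : realType) (T : topologicalType) (K : set T)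
    (J : T -> R) (I : Type) (P : I -> Prop) (h : I -> T -> R) (B : R) :
  compact K -> K !=set0 -> (forall g, K g -> J g <= B) ->
  (forall i, P i -> continuous (h i)) ->
  (forall g t, K g -> t <= J g <-> forall i, P i -> t <= h i g) ->
  exists2 g0, K g0 & forall g, K g -> J g <= J g0.
Proof.
move=> cK [k0 Kk0] JB ch Jh.
have hS : has_sup [set J g | g in K].
  by split; [exists (J k0); exists k0|exists B => _ [g Kg <-]; exact: JB].
pose M := sup [set J g | g in K].
have JM g : K g -> J g <= M.
  by move=> Kg; apply: sup_upper_bound => //; exists g.
pose S (e : R) := [set g | K g /\ M - e <= J g].
have S0 e : 0 < e -> S e !=set0.
  move=> e0; have [_ [g Kg <-] hg] := sup_adherent e0 hS.
  by exists g; split => //; exact: ltW.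
pose F := filter_from [set e : R | 0 < e] S.
have PF : ProperFilter F.
  apply: filter_from_proper; last exact: S0.
  apply: filter_from_filter; first by exists 1 => /=.
  move=> e e' /= e0 e'0; exists (Num.min e e') => /=; first by rewrite lt_min e0.
  by move=> g [Kg hg]; split; split => //; rewrite (le_trans _ hg)// lerD2l lerN2
    ge_min lexx ?orbT.
have FK : F K by exists 1 => //= g [].
have [g0 [Kg0 clg0]] := cK F PF FK.
exists g0 => // g Kg; rewrite (le_trans (JM _ Kg))//.
apply/ler_addgt0Pr => e e0; rewrite -lerBlDr; apply/(Jh _ _ Kg0) => i Pi.
have clS : closed (h i @^-1` [set x | M - e <= x]).
  by apply: closed_preimage_continuous; [exact: ch|exact: closed_ge].
apply: clS => U nU; apply: clg0 => //.
by exists e => //= g' [Kg' hg']; have /(Jh _ _ Kg')/(_ i Pi) := hg'.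
Qed.

Section real_continuous.
Context (R : realType) (T : topologicalType).

Lemma continuous_subZ (a : R) (k q : T -> R) : continuous k -> continuous q ->
  continuous (fun g => k g - a * q g).
Proof.
move=> ck cq g; apply: cvgB; first exact: ck.
by apply: cvgMl_tmp; exact: cq.
Qed.

Lemma continuous_lin_defect (a : R) (k1 k2 k3 : T -> R) :
  continuous k1 -> continuous k2 -> continuous k3 ->
  continuous (fun g => k1 g - (a * k2 g + k3 g)).
Proof.
move=> c1 c2 c3 g; apply: cvgB; first exact: c1.
apply: cvgD; last exact: c3.
by apply: cvgMl_tmp; exact: c2.
Qed.

Lemma continuous_sum_sqr (c h : nat -> R) (N : nat) (k : nat -> T -> R) :
  (forall n, continuous (k n)) ->
  continuous (fun g => \sum_(n < N) c n * (k n g - h n) ^+ 2).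
Proof.
move=> ck; elim: N => [|N IH].
  rewrite (_ : (fun _ => _) = fun=> 0); last first.
    by apply/funext => g; rewrite big_ord0.
  by move=> g; exact: cvg_cst.
rewrite (_ : (fun _ => _) = fun g => \sum_(n < N) c n * (k n g - h n) ^+ 2 +
    c N * ((k N g - h N) * (k N g - h N))); last first.
  by apply/funext => g; rewrite big_ord_recr.
move=> g; apply: cvgD; first exact: IH.
apply: cvgMl_tmp; apply: cvgM; apply: cvgB; by [exact: ck|exact: cvg_cst].
Qed.

End real_continuous.

(** The natural multiples of (- z, - |z|) lie on the graph of - |.|, and a functional
    below them, of norm at most 1, is at least |z| at z. *)
Lemma norming_functional (R : realType) (V : normedModType R) (z : V) :
  exists g : V -> R, [/\ forall a x y, g (a *: x + y) = a * g x + g y,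
    forall x, `|g x| <= `|x| & g z = `|z|].
Proof.
pose C (h : V) (r : R) := exists k : nat, h = k%:R *: (- z) /\ r = - (k%:R * `|z|).
have [||||g [glin g1 gC]] := @sandwich R V C 1 => //.
- by exists 0%N; rewrite scale0r mul0r oppr0.
- move=> h r h' r' [k [-> ->]] [k' [-> ->]]; exists (k + k')%N.
  by rewrite natrD scalerDl mulrDl opprD.
- move=> h r [k [-> ->]]; rewrite mul1r normrZ normrN.
  by rewrite [`|k%:R|]ger0_norm.
have {}g1 x : `|g x| <= `|x| by rewrite (le_trans (g1 x))// mul1r.
exists g; split => //; apply/eqP; rewrite eq_le (le_trans (ler_norm _) (g1 _))/=.
have gN : g (- z) = - g z.
  have g0 : g 0 = 0 by have := glin (-1) 0 0; rewrite scaler0 addr0 mulN1r addNr.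
  by have := glin (-1) z 0; rewrite scaleN1r addr0 mulN1r g0 addr0.
have : g (- z) <= - `|z|.
  by apply: gC; exists 1%N; rewrite scale1r mul1r.
by rewrite gN lerN2.
Qed.

Section smooth_norm.
Context (R : realType) (V : normedModType R) (W : set V).
Hypothesis Wsub : is_subspace W.

(** The unit ball of the dual of W, whose elements are functions on V of which only
    the values on W matter; the bound outside W makes it compact for the pointwise
    convergence. *)
Definition dual_ball : set {ptws V -> R} :=
  [set g | (forall v, `|g v| <= `|v|) /\
    forall (a : R) u v, W u -> W v -> g (a *: u + v) = a * g u + g v].

Lemma ptws_eval_continuous (v : V) : continuous (fun g : {ptws V -> R} => g v).
Proof. exact: (@proj_continuous V (fun _ => R) v). Qed.

Lemma dual_ball_compact : compact dual_ball.
Proof.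
apply: (@subclosed_compact _ _ [set g : {ptws V -> R} |
    forall v, `[- `|v|, `|v|]%classic (g v)]).
- rewrite (_ : dual_ball = \bigcap_(i in [set: V + R * V * V])
    (match i with
     | inl v => [set g : {ptws V -> R} | `|g v| <= `|v|]
     | inr (a, u, v) => [set g : {ptws V -> R} |
         W u -> W v -> g (a *: u + v) = a * g u + g v] end)).
    apply: closed_bigI => -[v|[[a u] v]] _.
    + apply: (@closed_preimage_continuous _ _ (fun g : {ptws V -> R} => `|g v|)
        [set x : R | x <= `|v|]); last exact: closed_le.
      move=> g; apply: continuous_comp; [exact: ptws_eval_continuous|exact: norm_continuous].
    + have [[Wu Wv]|nW] := pselect (W u /\ W v); last first.
        rewrite (_ : [set _ | _] = setT); first exact: closedT.
        by apply/seteqP; split => g //= _ Wu Wv; exfalso; apply: nW.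
      rewrite (_ : [set _ | _] =
          (fun g : {ptws V -> R} => g (a *: u + v) - (a * g u + g v)) @^-1` [set 0]).
        apply: closed_preimage_continuous; last exact: closed_eq.
        have ce x : continuous (fun g : {ptws V -> R} => g x).
          exact: ptws_eval_continuous.
        exact: (@continuous_lin_defect R {ptws V -> R} a _ _ _
          (ce (a *: u + v)) (ce u) (ce v)).
      apply/seteqP; split => g /=; first by move=> ->//; rewrite subrr.
      by move=> /eqP; rewrite subr_eq0 => /eqP.
  apply/seteqP; split => [g [g1 glin] [v|[[a u] v]] _ /=|g h].
  + exact: g1.
  + exact: glin.
  + split=> [v|a u v]; [exact: (h (inl v))|exact: (h (inr (a, u, v)))].
- apply: (@tychonoff V (fun _ => R) (fun v => `[- `|v|, `|v|]%classic)) => v.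
  exact: segment_compact.
- by move=> g [g1 _] v /=; rewrite in_itv /= -ler_norml.
Qed.

Section penalty.
Variable h : nat -> V -> R.
Hypothesis h_le : forall n v, W v -> `|h n v| <= 2 * `|v|.
Hypothesis h_dense : forall g, dual_ball g -> forall e, 0 < e ->
  exists n, forall v, W v -> `|v| <= 1 -> `|g v - h n v| <= e.

Let in_ball (w : nat -> V) := forall n, W (w n) /\ `|w n| <= 1.

Let Q (N : nat) (w : nat -> V) (g : V -> R) : R :=
  \sum_(n < N) 2^-1 ^+ n.+1 * (g (w n) - h n (w n)) ^+ 2.

(** theta g is the sum over n of |g - h n|^2 / 2^(n + 1), for the norm of the dual
    of W. It is written as a supremum over finitely many sampling points w n of the
    unit ball of W, which makes it lower semicontinuous for the pointwise
    convergence. *)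
Let theta (g : V -> R) : R :=
  sup [set Q Nw.1 Nw.2 g | Nw in [set Nw | in_ball Nw.2]].

Let half0 n : 0 < 2^-1 ^+ n :> R. Proof. by rewrite exprn_gt0// invr_gt0. Qed.

Let w0 : nat -> V := fun=> 0.

Let w0_in : in_ball w0.
Proof. by move=> n; rewrite /w0 normr0; split => //; exact: Wsub.1. Qed.

Let Q_le9 N w g : in_ball w -> dual_ball g -> Q N w g <= 9.
Proof.
move=> wb [g1 _].
suff : Q N w g <= 9 * (1 - 2^-1 ^+ N) by move=> /le_trans; apply; have := half0 N; lra.
elim: N => [|N IH]; first by rewrite /Q big_ord0 expr0 subrr mulr0.
rewrite /Q big_ord_recr /= -/(Q N w g) (le_trans (lerD IH (lexx _)))//.
have [Wn n1] := wb N.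
have : (g (w N) - h N (w N)) ^+ 2 <= 9.
  have : `|g (w N) - h N (w N)| <= 3.
    rewrite (le_trans (ler_normB _ _))//.
    have := g1 (w N); have := h_le N Wn; lra.
  by rewrite ler_norml => /andP[]; nra.
rewrite -(ler_pM2l (half0 N.+1)); rewrite exprS; lra.
Qed.

Let Q_mono N k w g : Q N w g <= Q (N + k)%N w g.
Proof.
elim: k => [|k IH]; first by rewrite addn0.
rewrite addnS (le_trans IH)// /Q big_ord_recr /= lerDl.
by rewrite mulr_ge0 ?sqr_ge0// ltW.
Qed.

Let theta_has g : dual_ball g ->
  has_sup [set Q Nw.1 Nw.2 g | Nw in [set Nw | in_ball Nw.2]].
Proof.
move=> gb; split; first by exists (Q 0 w0 g); exists (0%N, w0).
by exists 9 => _ [[N w] /= wb <-]; exact: Q_le9.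
Qed.

Let Q_le_theta N w g : in_ball w -> dual_ball g -> Q N w g <= theta g.
Proof.
by move=> wb gb; apply: sup_upper_bound; [exact: theta_has|exists (N, w)].
Qed.

Let theta_le g t : dual_ball g ->
  (forall N w, in_ball w -> Q N w g <= t) -> theta g <= t.
Proof.
move=> gb ht; apply: ge_sup => [|_ [[N w] /= wb <-]]; last exact: ht.
exact: (theta_has gb).1.
Qed.

Let theta_ge0 g : dual_ball g -> 0 <= theta g.
Proof.
by move=> gb; have := @Q_le_theta 0%N w0 g w0_in gb; rewrite /Q big_ord0.
Qed.

Let theta_le9 g : dual_ball g -> theta g <= 9.
Proof. by move=> gb; apply: theta_le => // N w wb; exact: Q_le9. Qed.

Let mid (g g' : V -> R) : V -> R := fun v => (g v + g' v) / 2.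

Let mid_ball g g' : dual_ball g -> dual_ball g' -> dual_ball (mid g g').
Proof.
move=> [g1 gl] [g1' gl']; split => [v|a u v Wu Wv]; last first.
  by rewrite /mid gl// gl'//; lra.
rewrite /mid normrM (@ger0_norm _ 2^-1)// ler_pdivrMr// (le_trans (ler_normD _ _))//.
have := g1 v; have := g1' v; lra.
Qed.

(** The parallelogram identity, applied to each term of Q. If g is away from g0 at
    v then, as h n is close to g0, the midpoint m is away from h n at v. So the n-th
    sampling point can be replaced by a point u at which m is away from h n without
    decreasing Q, and g is away from g0 at u; the loss in the parallelogram identity
    is the last term of the conclusion. *)
Let theta_mid g g0 n v e : dual_ball g -> dual_ball g0 -> 0 < e ->
  (forall v, W v -> `|v| <= 1 -> `|g0 v - h n v| <= e) ->
  W v -> `|v| <= 1 -> 6 * e < `|g v - g0 v| ->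
  theta (mid g g0) <= (theta g + theta g0) / 2 - 2^-1 ^+ n.+1 * e ^+ 2.
Proof.
move=> gb g0b e0 hn Wv v1 hv; set m := mid g g0.
apply: (theta_le (mid_ball gb g0b)) => N w wb.
pose u := if `|m (w n) - h n (w n)| <= `|m v - h n v| then v else w n.
have [Wu u1] : W u /\ `|u| <= 1 by rewrite /u; case: ifP => // _; exact: wb.
have mv : 2 * e < `|m v - h n v|.
  have -> : m v - h n v = (g v - g0 v) / 2 + (g0 v - h n v) by rewrite /m /mid; lra.
  have := lerB_normD ((g v - g0 v) / 2) (g0 v - h n v).
  rewrite normrM (@ger0_norm _ 2^-1)//.
  have := hn v Wv v1; lra.
have mu : `|m (w n) - h n (w n)| <= `|m u - h n u| /\ 2 * e < `|m u - h n u|.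
  rewrite /u; case: ifPn => // /negP/negP; rewrite -ltNge => lt_.
  by split => //; lra.
have gu : (2 * e) ^+ 2 <= (g u - g0 u) ^+ 2.
  have h1 : 2 * e <= `|g u - g0 u|.
    have -> : g u - g0 u = 2 * (m u - h n u) - 2 * (g0 u - h n u).
      by rewrite /m /mid; lra.
    have := lerB_dist (2 * (m u - h n u)) (2 * (g0 u - h n u)).
    rewrite !normrM (@ger0_norm _ 2)//.
    have := hn u Wu u1; have := mu.2; lra.
  rewrite -(@real_normK _ (g u - g0 u)) ?num_real//.
  by rewrite lerXn2r ?nnegrE// mulr_ge0// ltW.
pose w' k := if k == n then u else w k.
have wb' : in_ball w' by move=> k; rewrite /w'; case: ifP => // _; exact: wb.
have QQ' : Q N w m <= Q N w' m.
  apply: ler_sum => k _; rewrite /w'; have [kn|//] := eqVneq (k : nat) n.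
  rewrite kn ler_pM2l// -(@real_normK _ (m (w n) - _)) ?num_real//.
  rewrite -(@real_normK _ (m u - _)) ?num_real//.
  by rewrite lerXn2r ?nnegrE//; exact: mu.1.
apply: (le_trans QQ'); apply: (le_trans (Q_mono N n.+1 w' m)).
set M := (N + n.+1)%N; have nM : (n < M)%N by rewrite /M addnS ltnS leq_addl.
have -> : Q M w' m = (Q M w' g + Q M w' g0) / 2 -
    \sum_(k < M) 2^-1 ^+ k.+1 * (g (w' k) - g0 (w' k)) ^+ 2 / 4.
  rewrite /Q -big_split /= mulr_suml -sumrB; apply: eq_bigr => k _.
  by rewrite /m /mid; field.
have S : 2^-1 ^+ n.+1 * e ^+ 2 <=
    \sum_(k < M) 2^-1 ^+ k.+1 * (g (w' k) - g0 (w' k)) ^+ 2 / 4.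
  rewrite (bigD1 (Ordinal nM))//= {1}/w' {1}/w' eqxx.
  rewrite -[leLHS]addr0 lerD//; last first.
    by apply: sumr_ge0 => k _; rewrite divr_ge0// mulr_ge0 ?sqr_ge0// ltW.
  rewrite -mulrA ler_pM2l// ler_pdivlMr//.
  by move: gu; rewrite exprMn; lra.
have := Q_le_theta M wb' gb; have := Q_le_theta M wb' g0b; lra.
Qed.

Variable s : R.
Hypothesis s0 : 0 < s.

Let J (z : V) (g : V -> R) : R := g z - s * theta g.

Let J_max z : exists2 g0, dual_ball g0 & forall g, dual_ball g -> J z g <= J z g0.
Proof.
apply: (@compact_usc_max R {ptws V -> R} dual_ball (J z) (nat * (nat -> V))
  (fun Nw => in_ball Nw.2) (fun Nw g => g z - s * Q Nw.1 Nw.2 g) `|z|).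
- exact: dual_ball_compact.
- exists (fun=> 0); split => [v|a u v _ _]; first by rewrite normr0.
  by rewrite mulr0 addr0.
- move=> g gb; have := theta_ge0 gb; have := le_trans (ler_norm _) (gb.1 z).
  rewrite /J => h1 h2; have := mulr_ge0 (ltW s0) h2; lra.
- move=> [N w] /= _.
  have cz : continuous (fun g : {ptws V -> R} => g z).
    exact: ptws_eval_continuous.
  have cw n : continuous (fun g : {ptws V -> R} => g (w n)).
    exact: ptws_eval_continuous.
  have cQ := @continuous_sum_sqr R {ptws V -> R} (fun n => 2^-1 ^+ n.+1)
    (fun n => h n (w n)) N _ cw.
  exact: (@continuous_subZ R {ptws V -> R} s _ _ cz cQ).
- move=> g t gb; rewrite /J; split => [h1 [N w] /= wb|ht].
    have := Q_le_theta N wb gb; rewrite -(ler_pM2l s0); lra.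
  have : theta g <= (g z - t) / s; last by rewrite ler_pdivlMr// mulrC; lra.
  apply: theta_le => // N w wb; rewrite ler_pdivlMr// mulrC.
  by have := ht (N, w) wb; rewrite /=; lra.
Qed.

(** Maximizing sequences of J z converge in norm: the value of J z at the midpoint
    of g and g0 cannot exceed the maximum. *)
Let J_strong_max z g0 : dual_ball g0 -> (forall g, dual_ball g -> J z g <= J z g0) ->
  forall e, 0 < e -> exists2 eta, 0 < eta & forall g, dual_ball g ->
    J z g0 - eta < J z g -> forall v, W v -> `|v| <= 1 -> `|g v - g0 v| <= e.
Proof.
move=> g0b g0max e e0.
have e6 : 0 < e / 6 by lra.
have [n hn] := h_dense g0b e6.
exists (2 * s * (2^-1 ^+ n.+1 * (e / 6) ^+ 2)).
  by rewrite !mulr_gt0 ?exprn_gt0.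
move=> g gb hg v Wv v1; rewrite leNgt; apply/negP => hv.
have := @theta_mid g g0 n v (e / 6) gb g0b e6 hn Wv v1.
have -> : 6 * (e / 6) = e by lra.
move=> /(_ hv); rewrite -(ler_pM2l s0).
have := g0max _ (mid_ball gb g0b); move: hg; rewrite /J /mid; lra.
Qed.

(** r z is the maximum of J z over the dual ball. A maximizer of J v almost
    maximizes J z when v is close to z, hence is close in norm to the maximizer of
    J z, which is therefore a Frechet supergradient of r at z along W. *)
Lemma smooth_norm_of_dense : exists r : V -> R,
  [/\ forall z, `|z| - 9 * s <= r z <= `|z|,
      forall z z', W z -> W z' -> `|r z - r z'| <= `|z - z'| &
      forall z, W z -> exists2 g, dual_ball g & forall e, 0 < e ->
        exists2 d, 0 < d & forall v, W v -> `|v - z| < d ->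
          r v <= r z + g (v - z) + e * `|v - z|].
Proof.
have [gm hgm] := @choice _ _ (fun z g0 => dual_ball g0 /\
  forall g, dual_ball g -> J z g <= J z g0)
  (fun z => ltac:(by have [g0] := J_max z; exists g0)).
pose r z := J z (gm z).
have gB g u v : dual_ball g -> W u -> W v -> g (u - v) = g u - g v.
  move=> [_ gl] Wu Wv; have := gl (-1) v u Wv Wu.
  by rewrite scaleN1r mulN1r addrC => ->; rewrite addrC.
have rle z z' : W z -> W z' -> r z <= r z' + `|z - z'|.
  move=> Wz Wz'; have [b1 _] := hgm z; have [_ /(_ _ b1)] := hgm z'.
  have := le_trans (ler_norm _) (b1.1 (z - z')).
  by rewrite gB// /r /J; lra.
exists r; split.
- move=> z; have [b mx] := hgm z; apply/andP; split; last first.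
    have h1 := le_trans (ler_norm _) (b.1 z).
    by have := mulr_ge0 (ltW s0) (theta_ge0 b); rewrite /r /J; lra.
  have [g [gl g1 gz]] := norming_functional z.
  have gb : dual_ball g by split.
  have := mx g gb; rewrite -/(r z) /J gz.
  have := theta_le9 gb; rewrite -(ler_pM2l s0); lra.
- move=> z z' Wz Wz'; rewrite ler_norml.
  by have := rle z z' Wz Wz'; have := rle z' z Wz' Wz; rewrite (distrC z' z); lra.
- move=> z Wz; have [b mx] := hgm z; exists (gm z) => // e e0.
  have [eta eta0 heta] := J_strong_max b mx e0.
  exists (eta / 2); first by lra.
  move=> v Wv vz; have [bv mv] := hgm v.
  have Jv : J z (gm v) = r v - gm v (v - z) by rewrite gB// /r /J; lra.
  have g1 := le_trans (ler_norm _) (bv.1 (v - z)).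
  have close : J z (gm z) - eta < J z (gm v).
    by rewrite Jv -/(r z); have := rle z v Wz Wv; rewrite (distrC z v); lra.
  have {}close := heta _ bv close.
  have Wvz : W (v - z) by rewrite addrC -scaleN1r; exact: Wsub.2.
  have key : gm v (v - z) - gm z (v - z) <= e * `|v - z|.
    have [vz0|vz0] := eqVneq (v - z) 0.
      rewrite vz0 normr0 mulr0; have := bv.1 0; have := b.1 0.
      by rewrite normr0 !normr_le0 => /eqP-> /eqP->; rewrite subrr.
    have nz : 0 < `|v - z| by rewrite normr_gt0.
    have := close (`|v - z|^-1 *: (v - z)).
    have sc g : dual_ball g -> g (`|v - z|^-1 *: (v - z)) = `|v - z|^-1 * g (v - z).
      move=> [_ gl]; have W0 := Wsub.1.
      have g0 : g 0 = 0 by have := gl (-1) 0 0 W0 W0; rewrite scaler0 addr0 mulN1r addNr.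
      by have := gl (`|v - z|^-1) (v - z) 0 Wvz W0; rewrite addr0 g0 addr0.
    rewrite (sc _ bv) (sc _ b) -mulrBr normrZ normfV normr_id mulVf ?gt_eqF//.
    have Wu : W (`|v - z|^-1 *: (v - z)).
      by rewrite -[_ *: _]addr0; apply: Wsub.2 => //; exact: Wsub.1.
    move=> /(_ Wu (lexx _)); rewrite normrM normfV normr_id mulrC ler_pdivrMr//.
    exact: le_trans (ler_norm _).
  by have := mx _ bv; rewrite Jv -/(r z); lra.
Qed.

End penalty.

End smooth_norm.

(** The penalty is built on a dense sequence of the dual of W; the elements of norm
    greater than 2, which are far from the unit ball, are replaced by 0. *)
Lemma smooth_norm (R : realType) (V : normedModType R) (W : set V) (s : R) :
  is_subspace W -> separable_dual_on W -> 0 < s -> exists r : V -> R,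
  [/\ forall z, `|z| - s <= r z <= `|z|,
      forall z z', W z -> W z' -> `|r z - r z'| <= `|z - z'| &
      forall z, W z -> exists2 g, dual_ball W g & forall e, 0 < e ->
        exists2 d, 0 < d & forall v, W v -> `|v - z| < d ->
          r v <= r z + g (v - z) + e * `|v - z|].
Proof.
move=> Wsub [D [/countable_injP[i iinj] Ddual Ddense]] s0.
pose enum n := xget (fun=> 0) [set g | D g /\ i g = n].
have enumK g : D g -> enum (i g) = g.
  move=> Dg; rewrite /enum; case: xgetP => [g' _ [Dg' e]|/(_ g)/=[]//].
  by apply: iinj; rewrite ?inE.
pose h n := if `[< forall v, W v -> `|enum n v| <= 2 * `|v| >] then enum n else fun=> 0.
have h_le n v : W v -> `|h n v| <= 2 * `|v|.
  rewrite /h; case: asboolP => [h_le Wv|_ _]; first exact: h_le.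
  by rewrite normr0 mulr_ge0.
have h_dense g : dual_ball W g -> forall e, 0 < e ->
    exists n, forall v, W v -> `|v| <= 1 -> `|g v - h n v| <= e.
  move=> [g1 gl] e e0.
  have gW : dual_on W g.
    by apply: (@bounded_dual_on _ _ W g 1) => // v _; rewrite mul1r.
  have m0 : 0 < Num.min 1 e by rewrite lt_min ltr01.
  have [k Dk /ltW kg] := Ddense g gW _ m0.
  have [kl _] := Ddual k Dk.
  have {}kg v : W v -> `|g v - k v| <= Num.min 1 e * `|v|.
    apply: (@dual_norm_on_bound R V W (g \- k) _ Wsub) => // a x y Wx Wy.
    by rewrite /= gl// kl//; lra.
  exists (i k) => v Wv v1; rewrite /h enumK//; case: asboolP => [_|[]].
    rewrite (le_trans (kg _ Wv))// (@le_trans _ _ (e * `|v|))//.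
      by rewrite ler_wpM2r// ge_min lexx orbT.
    by rewrite ler_piMr// ltW.
  move=> w Ww; rewrite -[k w](subKr (g w)) (le_trans (ler_normB _ _))//.
  have := g1 w; have := kg w Ww.
  have : Num.min 1 e * `|w| <= 1 * `|w| by rewrite ler_wpM2r// ge_min lexx.
  lra.
have s9 : 0 < s / 9 by rewrite divr_gt0.
have [r [r1 r2 r3]] := @smooth_norm_of_dense R V W Wsub h h_le h_dense (s / 9) s9.
exists r; split => // z; have := r1 z.
by rewrite (_ : 9 * (s / 9) = s)//; lra.
Qed.

(** * Separable reduction *)

Lemma countable_closed_hull (T : Type) (I : countType) (F : I -> T -> T -> T)
    (x0 : T) : exists C : set T,
  [/\ countable C, C x0 & forall i x y, C x -> C y -> C (F i x y)].
Proof.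
(* the index None keeps the points already obtained *)
pose F' (i : option I) x y := if i is Some j then F j x y else x.
pose step (A : set T) : set T := [set F' p.1.1 p.1.2 p.2 | p in setT `*` A `*` A].
pose A n := iter n step [set x0].
have cA n : countable (A n).
  elim: n => [|n IH]; first exact: countable1.
  rewrite /A iterS -/(A n) /step.
  apply: sub_countable; first exact: card_image_le.
  by apply: countableX => //; apply: countableX => //; exact: countableP.
have Amono n k : A n `<=` A (n + k)%N.
  elim: k => [|k IH]; first by rewrite addn0.
  rewrite addnS => x /IH Ax; rewrite /A iterS.
  by exists (None, x, x).
exists (\bigcup_n A n); split.
- by apply: bigcup_countable => //; exact: countableP.
- by exists 0%N.
- move=> i x y [n _ Ax] [m _ Ay]; exists (n + m).+1 => //.
  rewrite /A iterS -/(A _); exists (Some i, x, y) => //; split; [split|] => //=.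
    exact: Amono.
  by rewrite addnC; exact: Amono.
Qed.

Section separable_reduction.
Context (R : realType) (V : normedModType R) (f : V -> \bar R) (c : R).
Hypothesis c0 : 0 <= c.
Implicit Types (x v : V) (b s : R) (l : seq (V * (nat * nat))).

(** A functional g with g (v - x) <= f v - b + |v - x| / (n + 1) whenever
    |v - x| < 1 / (m n + 1), for every n, is a Frechet subgradient of f at x if
    f x = b. In a list l, a point v comes with the pair (n, m n), and g evaluated at
    shift x l is then at most excess x b l. *)
Definition excess x b l : R :=
  \sum_(p <- l) (fine (f p.1) - b + `|p.1 - x| / p.2.1.+1%:R).

Definition shift x l : V := \sum_(p <- l) (p.1 - x).

(** An obstruction prevents such a functional from having norm at most c. The slack
    s quantifies strict inequalities. *)
Definition obstruction x b s l : Prop :=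
  (forall p, p \in l -> (f p.1 < +oo)%E /\ `|p.1 - x| + s <= p.2.2.+1%:R^-1) /\
  excess x b l + c * `|shift x l| + s <= 0.

Lemma obstruction_perturb x b s x' b' s' e l :
  `|x - x'| <= e -> `|b - b'| <= e -> (1 + (2 + c) * (size l)%:R) * e <= s - s' ->
  obstruction x b s l -> obstruction x' b' s' l.
Proof.
move=> xe be es [lx ls].
have e0 : 0 <= e by rewrite (le_trans _ xe).
have ses : s' + e <= s.
  have : 0 <= (2 + c) * (size l)%:R * e by rewrite !mulr_ge0// addr_ge0.
  lra.
have tri v : `|v - x'| <= `|v - x| + e.
  by rewrite -(subrKA x v) (le_trans (ler_normD _ _))// lerD2l.
split=> [p /lx[fp px]|]; first by split => //; apply: le_trans px; have := tri p.1; lra.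
have h1 : excess x' b' l <= excess x b l + 2 * (size l)%:R * e.
  rewrite /excess; elim: (l) => [|p l' IH]; first by rewrite !big_nil mulr0 mul0r addr0.
  rewrite !big_cons /=.
  have -> : (size l').+1%:R = (size l')%:R + 1 :> R by rewrite natr1.
  have : `|p.1 - x'| / p.2.1.+1%:R <= `|p.1 - x| / p.2.1.+1%:R + e.
    rewrite ler_pdivrMr// mulrDl divfK ?pnatr_eq0// (le_trans (tri _))// lerD2l.
    by rewrite ler_peMr// ler1n.
  move: (_ / _) (_ / _) IH => X Y IH.
  have := ler_norm (b - b'); lra.
have h2 : `|shift x' l| <= `|shift x l| + (size l)%:R * e.
  have -> : shift x' l = shift x l + (x - x') *+ size l.
    rewrite /shift; elim: (l) => [|p l' IH]; first by rewrite !big_nil addr0.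
    by rewrite !big_cons IH /= mulrS [RHS]addrACA subrKA.
  rewrite (le_trans (ler_normD _ _))// lerD2l normrMn mulr_natl.
  by rewrite lerMn2r xe orbT.
have h3 := ler_wpM2l c0 h2.
lra.
Qed.

(** W is the closure of a countable set C, closed under rational linear
    combinations and under a choice of obstructions at its points, for all rational
    values b and all lists of pairs (n, m). An obstruction at a point x of W is one at
    a point of C close to x, for which one made of points of C has been chosen, and
    the latter is an obstruction at x. *)
Lemma separable_reduction u : exists W : set V,
  [/\ is_subspace W, separable_on W, closed W, W u &
    forall x b s l, W x -> 0 < s -> obstruction x b s l ->
    exists l' s', [/\ forall p, p \in l' -> W p.1, 0 < s',
      map snd l' = map snd l & obstruction x b s' l']].
Proof.
pose wit (x : V) (k : rat * seq (nat * nat) * nat) : seq (V * (nat * nat)) :=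
  xget [::] [set l | map snd l = k.1.2 /\ obstruction x (ratr k.1.1) k.2.+1%:R^-1 l].
pose F (i : rat + (rat * seq (nat * nat) * nat) * nat) (x y : V) : V :=
  match i with
  | inl q => ratr q *: x + y
  | inr (k, j) => (nth (0, (0, 0)%N) (wit x k) j).1
  end.
have [C [cC Cu CF]] := countable_closed_hull F u.
have C0 : C 0.
  by have := CF (inl (-1)) u u Cu Cu; rewrite /F rmorphN1 scaleN1r addNr.
have clC x : closure C x <-> forall e, 0 < e -> exists2 y, C y & `|x - y| < e.
  split=> [Cx e e0|h U /nbhs_ballP[e /= e0 eU]].
    have [y [Cy]] := Cx _ (nbhsx_ballx x e e0).
    by rewrite -ball_normE /= => xy; exists y.
  have [y Cy xy] := h e e0; exists y; split => //.
  by apply: eU; rewrite -ball_normE.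
exists (closure C); split.
- split; first exact: subset_closure.
  move=> a x y /clC Cx /clC Cy; apply/clC => e e0.
  pose M := 1 + `|a| + `|x|.
  have M0 : 0 < M by rewrite /M; have := normr_ge0 a; have := normr_ge0 x; lra.
  pose d := Num.min 1 (e / (2 * M)).
  have d0 : 0 < d by rewrite lt_min ltr01 divr_gt0// mulr_gt0.
  have d1 : d <= 1 by rewrite ge_min lexx.
  have dM : d * M <= e / 2.
    have : d <= e / (2 * M) by rewrite ge_min lexx orbT.
    by rewrite invfM mulrA ler_pdivlMr.
  have [x' Cx' xx'] := Cx _ d0; have e2 : 0 < e / 2 by lra.
  have [y' Cy' yy'] := Cy _ e2.
  have [q /andP[aq qa]] : exists q : rat, a - d < ratr q < a + d.
    have [q] := @rat_in_itvoo R (a - d) (a + d) ltac:(lra).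
    by rewrite in_itv /= => hq; exists q.
  exists (ratr q *: x' + y'); first exact: (CF (inl q)).
  have aq' : `|a - ratr q| <= d by rewrite ler_norml; apply/andP; split; lra.
  have -> : a *: x + y - (ratr q *: x' + y') =
      (a *: (x - x') + (a - ratr q) *: x - (a - ratr q) *: (x - x')) + (y - y').
    rewrite opprD addrACA; congr (_ + _).
    rewrite !(scalerBr _ x) -addrA opprB (addrC ((a - _) *: x)) subrK.
    by rewrite [(a - _) *: x']scalerBl addrA subrK.
  rewrite (le_lt_trans (ler_normD _ _))//.
  have h1 : `|a *: (x - x') + (a - ratr q) *: x - (a - ratr q) *: (x - x')| <= d * M.
    rewrite (le_trans (ler_normB _ _))// (le_trans (lerD (ler_normD _ _) (lexx _)))//.
    rewrite !normrZ.
    have A1 : `|a| * `|x - x'| <= `|a| * d by rewrite ler_wpM2l// ltW.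
    have A2 : `|a - ratr q| * `|x| <= d * `|x| by rewrite ler_wpM2r.
    have A3 : `|a - ratr q| * `|x - x'| <= d * 1.
      by rewrite ler_pM//; exact: le_trans (ltW xx') d1.
    by rewrite /M !mulrDr; lra.
  lra.
- exists C; split => //; exact: subset_closure.
- exact: closed_closure.
- exact: subset_closure.
move=> x b s l /clC Cx s0 obs.
pose p := Num.truncn (2 / s); pose sp : R := p.+1%:R^-1.
have sp0 : 0 < sp by rewrite invr_gt0.
have sps : sp <= s / 2.
  rewrite /sp -[leRHS]invrK lef_pV2 ?posrE ?invr_gt0 ?divr_gt0// invf_div.
  by rewrite ltW// truncnS_gt.
pose K := 1 + (2 + c) * (size l)%:R.
have K0 : 0 < K.
  have : 0 <= (2 + c) * (size l)%:R by rewrite mulr_ge0// addr_ge0.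
  by rewrite /K; lra.
pose e := sp / 2 / K.
have e0 : 0 < e by rewrite !divr_gt0.
have Ke : K * e = sp / 2 by rewrite /e mulrCA divff ?mulr1// gt_eqF.
have [x' Cx' xx'] := Cx _ e0.
have [q /andP[bq qb]] : exists q : rat, b - e < ratr q < b + e.
  have [q] := @rat_in_itvoo R (b - e) (b + e) ltac:(lra).
  by rewrite in_itv /= => hq; exists q.
have bq' : `|b - ratr q| <= e by rewrite ler_norml; apply/andP; split; lra.
have obs' : obstruction x' (ratr q) sp l.
  by apply: (obstruction_perturb (ltW xx') bq' _ obs); rewrite -/K Ke; lra.
pose k := (q, map snd l, p).
have [wl wobs] : map snd (wit x' k) = map snd l /\
    obstruction x' (ratr q) sp (wit x' k).
  by have := xgetPex [::] (ex_intro _ l (conj erefl obs') : exists l',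
    map snd l' = k.1.2 /\ obstruction x' (ratr k.1.1) k.2.+1%:R^-1 l').
exists (wit x' k), (sp / 2); split => //; last 2 first.
- by rewrite divr_gt0.
- have sz : size (wit x' k) = size l by rewrite -(size_map snd) wl size_map.
  have x'x : `|x' - x| <= e by rewrite distrC; exact: ltW.
  have q'b : `|ratr q - b| <= e by rewrite distrC.
  by apply: (obstruction_perturb x'x q'b _ wobs); rewrite sz -/K Ke; lra.
move=> y yl; apply: subset_closure.
have := CF (inr (k, index y (wit x' k))) x' x' Cx' Cx'.
by rewrite /F nth_index.
Qed.

End separable_reduction.

(** * The Frechet subdifferential in Asplund spaces *)

Lemma limf_einf_ge0 (R : realType) (T : choiceType) (X : filteredType T)
    (F : set_system X) (q : X -> \bar R) :
  (forall e : R, 0 < e -> \forall v \near F, ((- e)%:E <= q v)%E) ->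
  (0 <= limf_einf q F)%E.
Proof.
move=> h; rewrite /limf_einf leeNr oppe0; apply/lee_addgt0Pr => e e0.
rewrite add0e; apply: ge_ereal_inf.
exists (ereal_sup ((\- q)%E @` [set v | ((- e)%:E <= q v)%E])).
  by exists [set v | ((- e)%:E <= q v)%E] => //; exact: h.
apply: ge_ereal_sup => _ [v /= hv <-].
by rewrite leeNl -EFinN.
Qed.

Section no_obstruction.
Context (R : realType) (V : normedModType R) (f : V -> \bar R) (c : R).
Hypotheses (c0 : 0 <= c) (fN : forall v, f v != -oo%E).

(** In the absence of obstructions, r >= - c |h| on the additive semigroup generated
    by the pairs (v - x, f v - b + |v - x| / (n + 1)) with |v - x| < 1 / (m n + 1), and
    the separating functional is a Frechet subgradient. *)
Lemma frechet_subdiff_slope_le x b (m : nat -> nat) : f x = b%:E ->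
  (forall l s, 0 < s -> (forall p, p \in l -> p.2.2 = m p.2.1) ->
    ~ obstruction f c x b s l) ->
  (subdiff_slope (frechet_subdiff f) x <= c%:E)%E.
Proof.
move=> fx noobs.
pose adm (l : seq (V * (nat * nat))) := forall p, p \in l ->
  [/\ p.2.2 = m p.2.1, (f p.1 < +oo)%E & `|p.1 - x| < (m p.2.1).+1%:R^-1].
pose C h r := exists l, [/\ adm l, h = shift x l & r = excess f x b l].
have C0 : C 0 0.
  by exists [::]; split => //; rewrite /shift /excess big_nil.
have CD h r h' r' : C h r -> C h' r' -> C (h + h') (r + r').
  move=> [l [al -> ->]] [l' [al' -> ->]]; exists (l ++ l').
  split; rewrite /shift /excess ?big_cat// => p.
  by rewrite mem_cat => /orP[/al|/al'].
have slack l : adm l -> exists2 s, 0 < s &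
    forall p, p \in l -> `|p.1 - x| + s <= (m p.2.1).+1%:R^-1.
  elim: l => [_|p l IH alp]; first by exists 1.
  have [|s s0 hs] := IH; first by move=> q ql; apply: alp; rewrite inE ql orbT.
  have [_ _ hp] := alp p (mem_head _ _).
  exists (Num.min s ((m p.2.1).+1%:R^-1 - `|p.1 - x|)).
    by rewrite lt_min s0 subr_gt0.
  move=> q; rewrite inE => /predU1P[->|/hs hq].
    by rewrite -lerBrDl ge_min lexx orbT.
  by rewrite (le_trans _ hq)// lerD2l ge_min lexx.
have Clb h r : C h r -> - (c * `|h|) <= r.
  move=> [l [al -> ->]]; rewrite leNgt; apply/negP => lt0.
  have [s s0 hs] := slack _ al.
  pose t := Num.min s (- (c * `|shift x l|) - excess f x b l).
  have t0 : 0 < t by rewrite lt_min s0 subr_gt0.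
  apply: (noobs l t t0); first by move=> p /al[].
  split.
    move=> p pl; have [mp fp _] := al _ pl; split => //.
    by rewrite mp (le_trans _ (hs _ pl))// lerD2l ge_min lexx.
  have : t <= - (c * `|shift x l|) - excess f x b l by rewrite ge_min lexx orbT.
  lra.
have [g [glin gc gC]] := sandwich c0 C0 CD Clb.
apply: ge_ereal_inf; exists (dual_norm g); last exact: dual_norm_on_le.
exists g => //; split.
- by rewrite fx ltry.
- exact: (@bounded_dual_on _ _ setT g c).
apply: limf_einf_ge0 => e e0.
pose n := Num.truncn e^-1.
have ne : n.+1%:R^-1 <= e.
  by rewrite -[leRHS]invrK lef_pV2 ?posrE ?invr_gt0// ltW// truncnS_gt.
have d0 : 0 < (m n).+1%:R^-1 :> R by rewrite invr_gt0.
rewrite near_withinE; apply/nbhs_ballP; exists ((m n).+1%:R^-1) => //= v.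
rewrite -ball_normE /= distrC => vx vnx.
have nvx : 0 < `|v - x| by rewrite normr_gt0 subr_eq0.
have nvx' : 0 < `|v - x|^-1 by rewrite invr_gt0.
case fv : (f v) (fN v) => [q| |]// _; last first.
  by rewrite fx addye// gt0_mulye ?lte_fin// leey.
have : g (v - x) <= q - b + `|v - x| / n.+1%:R.
  apply: gC; exists [:: (v, (n, m n))]; split.
  - by move=> p; rewrite inE => /eqP -> /=; rewrite fv ltry.
  - by rewrite /shift big_seq1.
  - by rewrite /excess big_seq1 /= fv.
rewrite fx -!EFinB -EFinM lee_fin ler_pdivlMr// => h.
have h2 : `|v - x| / n.+1%:R <= e * `|v - x| by rewrite mulrC ler_pM2r.
move: (_ / _) h h2 => k h h2; lra.
Qed.

End no_obstruction.

Section asplund.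
Context (R : realType) (V : normedModType R) (f : V -> \bar R).
Hypotheses (fN : forall v, f v != -oo%E) (lf : lower_semicontinuous f).
Hypotheses (cV : complete_metric (normed_metric V)) (aV : asplund V).

(** Let y be given by the variational principle on W, with smooth approximations of
    the norm as penalties. Up to the sign, a supergradient at y of the sum of the
    first N.+1 penalties, called G N.+1 below, is an eps-subgradient of f at y along
    W, with eps close to tau / 2^N. As G M.+1 - G N.+1 has norm at most tau / 2^N for
    M >= N, a single M serves for all the points of a finite list, and - G M.+1 shows
    that the list is not an obstruction. *)
Lemma no_obstruction_near (W : set V) u (a c c' rho : R) :
  is_subspace W -> separable_dual_on W -> closed W -> W u -> f u = a%:E ->
  0 <= c -> c < c' -> 0 < rho ->
  (forall v, `|v - u| <= rho -> (f u <= f v + (c * `|v - u|)%:E)%E) ->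
  exists y b (m : nat -> nat), [/\ W y, `|y - u| < rho, f y = b%:E,
    `|b - a| < rho &
    forall l s, 0 < s -> (forall p, p \in l -> W p.1 /\ p.2.2 = m p.2.1) ->
      ~ obstruction f c' y b s l].
Proof.
move=> Wsub Wsep Wcl Wu fu c0 cc' rho0 umin.
have WB v w : W v -> W w -> W (v - w).
  by move=> Wv Ww; rewrite addrC -scaleN1r; exact: Wsub.2.
pose tau := (c' - c) / 3; pose kappa := c' - tau.
have tau0 : 0 < tau by rewrite /tau; lra.
have kap0 : 0 < kappa by rewrite /kappa /tau; lra.
(* t0 = kappa s0 is small enough for y and f y to be within rho of u and f u *)
pose Pc := (1 + c) * (1 + tau) * 2.
have c1 : 0 < 1 + c by lra.
have tau1 : 0 < 1 + tau by lra.
have Pc0 : 0 < Pc by rewrite /Pc !mulr_gt0.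
pose t0 := rho * tau / Pc.
have t00 : 0 < t0 by rewrite divr_gt0// mulr_gt0.
have t0rho : t0 * Pc = rho * tau by rewrite /t0 divfK// gt_eqF.
pose s0 := t0 / kappa; have s00 : 0 < s0 by rewrite divr_gt0.
have ks0 : kappa * s0 = t0 by rewrite /s0 mulrC divfK// gt_eqF.
have [r hr] := @choice R (V -> R) (fun s r => 0 < s ->
  [/\ forall z, `|z| - s <= r z <= `|z|,
      forall z z', W z -> W z' -> `|r z - r z'| <= `|z - z'| &
      forall z, W z -> exists2 g, dual_ball W g & forall e, 0 < e ->
        exists2 d, 0 < d & forall v, W v -> `|v - z| < d ->
          r v <= r z + g (v - z) + e * `|v - z|])
  (fun s => match pselect (0 < s) with
    | left sp => let: ex_intro r hr := smooth_norm Wsub Wsep sp in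
        ex_intro _ r (fun _ => hr)
    | right sp => ex_intro _ (fun=> 0) (fun sp' => match sp sp' with end) end).
pose E := W `&` [set v | `|v - u| <= rho].
have [||||||||||y [ak [sk [Ey a0 sk0 Eak ymin]]]] := @variational_principle R
  (normed_metric V) E f (fun p s v => r s (v - p)) u s0 kappa tau (a - c * rho) cV.
- apply: closedI => //.
  have cn : continuous (fun v : V => `|v - u|).
    move=> v; apply: cvg_norm; apply: cvgB; [exact: cvg_id|exact: cvg_cst].
  exact: (closed_preimage_continuous cn (@closed_le R rho)).
- exact: lf.
- move=> v [Wv vu]; have := umin v vu; rewrite fu.
  case: (f v) (fN v) => [q| |]//; rewrite ?leey// -EFinD !lee_fin => _.
  have : c * `|v - u| <= c * rho by rewrite ler_wpM2l.
  lra.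
- by split; rewrite /= ?subrr ?normr0 ?ltW.
- by rewrite fu ltry.
- exact: s00.
- exact: kap0.
- exact: tau0.
- move=> p s v _ /hr[h _ _] _; exact: h.
- move=> p s v w [Wp _] /hr[_ h _] [Wv _] [Ww _].
  rewrite (le_trans (h _ _ (WB _ _ Wv Wp) (WB _ _ Ww Wp)))//.
  rewrite opprB addrA subrK.
  by rewrite distrC.
pose cw k := if k is 0 then kappa else tau * 2^-1 ^+ k.
have half0 n : 0 < 2^-1 ^+ n :> R by rewrite exprn_gt0// invr_gt0.
have cw0 k : 0 < cw k by case: k => [|k] /=; [exact: kap0|rewrite mulr_gt0].
pose H N v := \sum_(k < N) cw k * r (sk k) (v - ak k).
have {}ymin N v : E v ->
    (f y + (H N.+1 y)%:E <= f v + (H N.+1 v + tau * 2^-1 ^+ N * `|v - y|)%:E)%E.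
  by move=> Ev; have := ymin N v Ev; rewrite (distrC v y).
have Wy : W y := Ey.1.
have Wz k : W (y - ak k) by apply: WB => //; exact: (Eak k).1.1.
have Eu : E u by split; rewrite /= ?subrr ?normr0 ?ltW.
have [b fy] : exists b, f y = b%:E.
  have := ymin 0%N u Eu; rewrite fu.
  by case: (f y) (fN y) => [b| |] //; exists b.
(* minimality of y compared with u, then of u compared with y *)
have fyA : b + kappa * `|y - u| - t0 <= a + tau * `|y - u|.
  have := ymin 0%N u Eu; rewrite fu fy /H !big_ord_recl !big_ord0 !addr0 /= a0 sk0.
  rewrite -!EFinD lee_fin expr0 mulr1 subrr (distrC u y).
  have [h _ _] := hr _ s00; have /andP[h1 _] := h (y - u).
  have /andP[_ h2] := h 0; rewrite normr0 in h2.
  have := ler_wpM2l (ltW kap0) h1; have := ler_wpM2l (ltW kap0) h2.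
  rewrite mulrBr ks0 mulr0; lra.
have fyB : a <= b + c * `|y - u|.
  by have := umin y Ey.2; rewrite fu fy -EFinD lee_fin.
have yuP : Pc * `|y - u| <= rho.
  rewrite -(ler_pM2r tau0) -t0rho mulrC mulrCA mulrA (mulrC t0) -mulrA ler_pM2l//.
  by move: fyA fyB; rewrite /kappa /tau; lra.
have yu0 := normr_ge0 (y - u).
have yuc : 2 * ((1 + c) * `|y - u|) <= rho.
  apply: le_trans yuP.
  have -> : Pc * `|y - u| = 2 * ((1 + c) * `|y - u|) * (1 + tau) by rewrite /Pc; ring.
  have h : 0 <= (1 + c) * `|y - u| by rewrite mulr_ge0// ltW.
  by apply: ler_peMr; lra.
have yurho : `|y - u| < rho.
  have : 0 <= c * `|y - u| by rewrite mulr_ge0.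
  lra.
have t0rho2 : 2 * t0 <= rho.
  rewrite -(ler_pM2r tau0) -t0rho /Pc.
  have h : 0 <= t0 * (1 + c * (1 + tau)).
    apply: mulr_ge0; first exact: ltW.
    by have := mulr_ge0 c0 (ltW tau1); lra.
  lra.
have bar : `|b - a| < rho.
  have h1 : tau * `|y - u| <= kappa * `|y - u|.
    by rewrite ler_wpM2r// /kappa /tau; lra.
  have := rho0; rewrite ltr_norml; move: fyA fyB; lra.
have [g hg] := choice (fun k => let: And3 _ _ h := hr _ (Eak k).2 in
  let: ex_intro2 g gb gd := h _ (Wz k) in
  ex_intro (fun g => dual_ball W g /\ forall e, 0 < e ->
    exists2 d, 0 < d & forall v, W v -> `|v - (y - ak k)| < d ->
    r (sk k) v <= r (sk k) (y - ak k) + g (v - (y - ak k)) + e * `|v - (y - ak k)|)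
  g (conj gb gd)).
pose G N v := \sum_(k < N) cw k * g k v.
have GD N v w : W v -> W w -> G N (v + w) = G N v + G N w.
  move=> Wv Ww; rewrite /G -big_split /=; apply: eq_bigr => k _.
  by have := (hg k).1.2 1 v w Wv Ww; rewrite scale1r mul1r => ->; rewrite mulrDr.
have Hdiff N e : 0 < e -> exists2 d, 0 < d & forall v, W v -> `|v - y| < d ->
    H N v <= H N y + G N (v - y) + e * `|v - y|.
  elim: N e => [|N IH] e e0.
    exists 1 => // v _ _; rewrite /H /G !big_ord0 !add0r mulr_ge0//.
    exact: ltW.
  have e2 : 0 < e / 2 by lra.
  have [d1 d10 h1] := IH _ e2.
  have [d2 d20 h2] := (hg N).2 _ (divr_gt0 e2 (cw0 N)).
  exists (Num.min d1 d2); first by rewrite lt_min d10.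
  move=> v Wv; rewrite lt_min => /andP[vd1 vd2].
  have := h2 (v - ak N) (WB _ _ Wv (Eak N).1.1).
  have -> : v - ak N - (y - ak N) = v - y by rewrite opprB addrA subrK.
  move=> /(_ vd2); rewrite -(ler_pM2l (cw0 N)) => {}h2.
  have := h1 v Wv vd1; rewrite /H /G !big_ord_recr /=.
  move: h2; rewrite !mulrDr.
  have -> : cw N * (e / 2 / cw N * `|v - y|) = e / 2 * `|v - y|.
    by field; rewrite gt_eqF.
  lra.
have Gtail N k w : `|G (N + k).+1 w - G N.+1 w| <=
    tau * (2^-1 ^+ N - 2^-1 ^+ (N + k)) * `|w|.
  elim: k => [|k IH]; first by rewrite addn0 !subrr mulr0 mul0r normr0.
  rewrite addnS /G big_ord_recr /= -/(G (N + k).+1 w) addrAC.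
  rewrite (le_trans (ler_normD _ _))//.
  have h1 : `|cw (N + k).+1 * g (N + k).+1 w| <= tau * 2^-1 ^+ (N + k).+1 * `|w|.
    by rewrite normrM (gtr0_norm (cw0 _)) ler_pM2l//; exact: (hg _).1.1.
  rewrite (le_trans (lerD IH h1))// exprS le_eqVlt; apply/orP; left.
  by apply/eqP; field.
have Gle N w : `|G N.+1 w| <= c' * `|w|.
  have h1 := Gtail 0%N N w; rewrite add0n in h1.
  have h2 : `|G 1%N w| <= kappa * `|w|.
    rewrite /G big_ord_recl big_ord0 addr0 normrM (gtr0_norm (cw0 _)) ler_pM2l//.
    exact: (hg _).1.1.
  have h3 : tau * (2^-1 ^+ 0 - 2^-1 ^+ N) * `|w| <= tau * `|w|.
    rewrite ler_wpM2r// expr0 ger_pMr//; have := half0 N; lra.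
  have -> : G N.+1 w = (G N.+1 w - G 1%N w) + G 1%N w by rewrite subrK.
  rewrite (le_trans (ler_normD _ _))//.
  have -> : c' * `|w| = tau * `|w| + kappa * `|w| by rewrite /kappa; ring.
  by apply: lerD h2; exact: le_trans h3.
have subgrad n : exists Nm : nat * nat, tau * 2^-1 ^+ Nm.1 <= n.+1%:R^-1 / 4 /\
    forall v, W v -> `|v - y| < Nm.2.+1%:R^-1 ->
    (b%:E <= f v + (G Nm.1.+1 (v - y) + n.+1%:R^-1 / 2 * `|v - y|)%:E)%E.
  set q : R := n.+1%:R^-1.
  have q0 : 0 < q / 4 by rewrite divr_gt0// invr_gt0.
  have [N _ /(_ N (leqnn N)) /= /ltW Nq] := cvgr_lt _ (@half_pow_cvg R tau) _ q0.
  have [d d0 hd] := Hdiff N.+1 _ q0.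
  have m0 : 0 < Num.min d (rho - `|y - u|) by rewrite lt_min d0 subr_gt0.
  exists (N, Num.truncn (Num.min d (rho - `|y - u|))^-1); split => // v Wv /= vy.
  have : `|v - y| < Num.min d (rho - `|y - u|).
    rewrite (lt_le_trans vy)// -[leRHS]invrK lef_pV2 ?posrE ?invr_gt0//.
    by rewrite ltW// truncnS_gt.
  rewrite lt_min => /andP[vd vrho].
  have Ev : E v.
    by split => //=; rewrite -(subrKA y v) (le_trans (ler_normD _ _))//; lra.
  have := ymin N v Ev; rewrite fy.
  case fv : (f v) (fN v) => [p| |]// _; last by move=> _; rewrite addye// leey.
  rewrite -!EFinD !lee_fin.
  have := hd v Wv vd; have := ler_wpM2r (normr_ge0 (v - y)) Nq; lra.
have [Nm hNm] := choice subgrad.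
exists y, b, (fun n => (Nm n).2); split => // l s sp hl [lx].
suff : 0 <= excess f y b l + c' * `|shift y l| by lra.
pose M := \max_(p <- l) (Nm p.2.1).1.
have MN p : p \in l -> ((Nm p.2.1).1 <= M)%N.
  by move=> pl; rewrite /M (big_rem p)//= leq_maxl.
have Wshift (l' : seq (V * (nat * nat))) : {subset l' <= l} -> W (shift y l').
  elim: l' => [|p l' IH] sub; first by rewrite /shift big_nil; exact: Wsub.1.
  rewrite /shift big_cons -[p.1 - y]scale1r; apply: Wsub.2.
    by apply: WB => //; have [] := hl p (sub _ (mem_head _ _)).
  by apply: IH => q ql; apply: sub; rewrite inE ql orbT.
suff : - G M.+1 (shift y l) <= excess f y b l.
  by have := ler_norm (G M.+1 (shift y l)); have := Gle M (shift y l); lra.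
have : {subset l <= l} by [].
elim: {-2}l => [|p l' IH] sub.
  rewrite /shift /excess !big_nil.
  by have := GD M.+1 0 0 Wsub.1 Wsub.1; rewrite addr0; lra.
have pl : p \in l by apply: sub; exact: mem_head.
have subl' : {subset l' <= l} by move=> q ql; apply: sub; rewrite inE ql orbT.
have [Wp mp] := hl p pl.
have Wpy : W (p.1 - y) by exact: WB.
have := IH subl'; rewrite /shift /excess !big_cons -/(shift y l') -/(excess f y b l').
rewrite GD//; last exact: Wshift.
rewrite opprD => IHle; suff : - G M.+1 (p.1 - y) <=
    fine (f p.1) - b + `|p.1 - y| / p.2.1.+1%:R by move=> h; exact: lerD h IHle.
have [fp] := lx p pl; rewrite mp => py.
have [Nq /(_ p.1 Wp)] := hNm p.2.1.
have {}py : `|p.1 - y| < (Nm p.2.1).2.+1%:R^-1.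
  by apply: lt_le_trans py; rewrite ltrDl.
move=> /(_ py).
case: (f p.1) fp (fN p.1) => [q| |]// _ _; rewrite -EFinD lee_fin /=.
have := Gtail (Nm p.2.1).1 (M - (Nm p.2.1).1)%N (p.1 - y).
rewrite subnKC ?MN// => h1.
have h2 : tau * (2^-1 ^+ (Nm p.2.1).1 - 2^-1 ^+ M) * `|p.1 - y| <=
    p.2.1.+1%:R^-1 / 4 * `|p.1 - y|.
  rewrite ler_wpM2r// (le_trans _ Nq)// ler_pM2l// gerBl; exact: ltW.
have := le_trans h1 h2; rewrite ler_norml => /andP[h3 _].
have h4 : 0 <= p.2.1.+1%:R^-1 * `|p.1 - y| by rewrite mulr_ge0// invr_ge0.
rewrite [_ / p.2.1.+1%:R]mulrC; move: (p.2.1.+1%:R^-1) h3 h4 => k h3 h4; lra.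
Qed.

End asplund.

Section frechet.
Context (R : realType) (V : normedModType R) (f : V -> \bar R).
Hypotheses (fN : forall v, f v != -oo%E) (lf : lower_semicontinuous f).
Hypotheses (cV : complete_metric (normed_metric V)) (aV : asplund V).

(** The fuzzy sum rule for f and c |. - u|. *)
Lemma frechet_slope_near u (a c c' eta : R) : f u = a%:E -> 0 <= c -> c < c' ->
  0 < eta -> (\forall v \near u, (f u <= f v + (c * `|v - u|)%:E)%E) ->
  exists x b, [/\ `|x - u| < eta, f x = b%:E, `|b - a| < eta &
    (subdiff_slope (frechet_subdiff f) x <= c'%:E)%E].
Proof.
move=> fu c0 cc' eta0 /nbhs_ballP[d /= d0 hd].
have c'0 : 0 <= c' by lra.
have [W [Wsub Wsep Wcl Wu Wred]] := separable_reduction f c'0 u.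
pose rho := Num.min (d / 2) eta.
have rhod : rho < d.
  have : rho <= d / 2 by rewrite ge_min lexx.
  lra.
have rhoeta : rho <= eta by rewrite ge_min lexx orbT.
have rho0 : 0 < rho by rewrite lt_min eta0 andbT divr_gt0.
have umin v : `|v - u| <= rho -> (f u <= f v + (c * `|v - u|)%:E)%E.
  by move=> vu; apply: hd; rewrite -ball_normE /= distrC (le_lt_trans vu).
have [x [b [m [Wx xu fx ba noobs]]]] := no_obstruction_near fN lf cV Wsub
  (aV Wsub Wsep) Wcl Wu fu c0 cc' rho0 umin.
exists x, b; split => //; [exact: lt_le_trans xu _|exact: lt_le_trans ba _|].
apply: (@frechet_subdiff_slope_le R V f c' c'0 fN x b m fx) => l s s0 lm obs.
have [l' [s' [l'W s'0 l'l obs']]] := Wred x b s l Wx s0 obs.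
apply: (noobs l' s' s'0 _ obs') => p pl'; split; first exact: l'W.
have : p.2 \in map snd l by rewrite -l'l map_f.
by move=> /mapP[q /lm qm ->].
Qed.

End frechet.

(** The point x is u itself, except for the Frechet subdifferential slope. *)
Lemma slope_ops0_near (R : realType) (X : metricType R) (f s : X -> \bar R) :
  slope_ops0 f s -> complete_metric X -> lower_semicontinuous f ->
  proper_valued f -> forall u (a c c' eta : R), f u = a%:E -> 0 <= c -> c < c' ->
  0 < eta -> (\forall v \near u, (f u <= f v + (c * mdist v u)%:E)%E) ->
  exists x b, [/\ mdist u x < eta, f x = b%:E, `|b - a| < eta &
    (s x <= c'%:E)%E].
Proof.
move=> h; case: X f s / h => [X f|V f|V f aV] cX lf fN u a c c' eta fu c0 cc' eta0 umin.
- exists u, a; split; rewrite ?mdistxx ?subrr ?normr0//.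
  by rewrite (le_trans (slope_le fN fu c0 umin))// lee_fin ltW.
- have umin' : \forall v \near (u : V), (f u <= f v + (c * `|v - u|)%:E)%E.
    by apply: filterS umin => v; rewrite /mdist /= (distrC u v).
  exists u, a; split; rewrite ?mdistxx ?subrr ?normr0//.
  rewrite (le_trans (@clarke_subdiff_slope_le R V f u a fN fu c c0 umin'))//.
  by rewrite lee_fin ltW.
- have umin' : \forall v \near (u : V), (f u <= f v + (c * `|v - u|)%:E)%E.
    by apply: filterS umin => v; rewrite /mdist /= (distrC u v).
  exact: (@frechet_slope_near R V f fN lf cX aV u a c c' eta fu c0 cc' eta0 umin').
Qed.

(** * Sufficient conditions *)

Section sufficiency.
Context (R : realType) (phi : R -> R) (hphi : class_C1 phi).
Context (X : metricType R) (f : X -> \bar R) (fN : proper_valued f).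
Local Notation phi' := (phi^`()%classic).

(** For the Frechet slope, the assumption is used at a point x near u where f is
    close to f u. *)
Lemma far_strip_open xbar delta mu (alpha : R) u (a gam : R) :
  far_strip phi f xbar delta mu alpha u -> f u = a%:E -> phi' a < gam ->
  exists2 eta, 0 < eta & forall x b, mdist u x < eta -> f x = b%:E ->
    `|b - a| < eta -> far_strip phi f xbar delta mu alpha x /\ phi' b < gam.
Proof.
move=> [[ud us] uf] fu agam.
have a0 : 0 < a by move: us => /andP[+ _]; rewrite fu lte_fin.
set M := Num.max _ _ in uf.
have M0 : 0 <= M by rewrite /M le_max; have [//|] := leP 0 alpha => /=; lra.
rewrite fu extend_fin ?ltW// -EFinM in uf.
have [L ML LD] : exists2 L : R, M * phi a < L & (L%:E < dist_to u (sublevel0 f))%E.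
  move: uf; case: (dist_to u _) => [D| |]//.
    by rewrite lte_fin => h; exists ((M * phi a + D) / 2); rewrite ?lte_fin; lra.
  by exists (M * phi a + 1); rewrite ?ltry//; lra.
have e0 : 0 < (L - M * phi a) / 2 / (1 + M) by rewrite !divr_gt0//; lra.
have near_ball : \forall eta \near 0^'+, (((mdist xbar u + eta)%R)%:E < delta)%E.
  move: ud; rewrite /eball /=; case: (delta) => [r| |]//.
    rewrite lte_fin => ur; have ur' : 0 < r - mdist xbar u by lra.
    near=> eta; rewrite lte_fin.
    have : eta < r - mdist xbar u by near: eta; exact: nbhs_right_lt.
    lra.
  by move=> _; apply: nearW => eta; rewrite ltry.
have near_mu : \forall eta \near 0^'+, ((a + eta)%:E < mu)%E.
  move: us => /andP[_]; rewrite fu; case: (mu) => [r| |]//.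
    rewrite lte_fin => ar; have ar' : 0 < r - a by lra.
    near=> eta; rewrite lte_fin.
    have : eta < r - a by near: eta; exact: nbhs_right_lt.
    lra.
  by move=> _; apply: nearW => eta; rewrite ltry.
have pae : phi a < phi a + (L - M * phi a) / 2 / (1 + M) by rewrite ltrDl.
have [d1 /= d10 hd1] := cvgr_lt _ (class_C1_continuous hphi a0) _ pae.
have cphi' : {for a, continuous phi'} by case: hphi => _ _ _ /(_ a a0)[].
have [d2 /= d20 hd2] := cvgr_lt _ cphi' _ agam.
near (0 : R)^'+ => eta.
have eta0 : 0 < eta by near: eta; exact: nbhs_right_gt.
have eta_d1 : eta < d1 by near: eta; exact: nbhs_right_lt.
have eta_d2 : eta < d2 by near: eta; exact: nbhs_right_lt.
have eta_a : eta < a by near: eta; exact: nbhs_right_lt.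
have eta_L : eta < (L - M * phi a) / 2.
  by near: eta; apply: nbhs_right_lt; lra.
exists eta => // x b ux fx ba.
have b0 : 0 < b by move: ba; rewrite ltr_norml; lra.
split; last by apply: hd2 => /=; rewrite distrC (lt_trans ba).
split; first split.
- rewrite /eball /= (le_lt_trans (_ : _ <= (mdist xbar u + eta)%:E)%E)//.
    rewrite lee_fin (le_trans (metric_triangle _ u _))// lerD2l ltW//.
  by near: eta.
- rewrite /strip /= fx lte_fin b0 /= (le_lt_trans (_ : _ <= (a + eta)%:E)%E)//.
    by rewrite lee_fin; move: ba; rewrite ltr_norml; lra.
  by near: eta.
rewrite fx extend_fin ?ltW// -EFinM -/M.
have := lt_le_trans LD (dist_to_triangle u x (sublevel0 f)).
rewrite -lteBlDr// -EFinB; apply: le_lt_trans; rewrite lee_fin.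
have : phi b < phi a + (L - M * phi a) / 2 / (1 + M).
  by apply: hd1 => /=; rewrite distrC (lt_trans ba).
move=> /ltW/(ler_wpM2l M0); rewrite mulrDr => h.
have : M * ((L - M * phi a) / 2 / (1 + M)) <= (L - M * phi a) / 2.
  by rewrite mulrA ler_pdivrMr; nra.
lra.
Unshelve. all: by end_near. Qed.

Variables (xbar : X) (delta mu : \bar R) (alpha : R).
Hypotheses (cX : complete_metric X) (lf : lower_semicontinuous f).
Hypotheses (al01 : 0 < alpha <= 1) (de0 : (0 < delta)%E).
Hypothesis xde : sublevel0 f xbar \/ delta = +oo%E.
Local Notation far := (far_strip phi f xbar delta mu alpha).
Local Notation eb :=
  (error_bound phi f xbar (delta * ((1 + alpha)^-1)%:E)%E mu).

Let al0 : 0 < alpha. Proof. by case/andP: al01. Qed.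

Let scaled_contra (k : R) (y : \bar R) (z : R) : 0 < z -> z * k < 1 ->
  (y <= k%:E)%E -> (1 <= z%:E * y)%E -> False.
Proof.
move=> z0 zk yk h.
have : (1 <= z%:E * k%:E)%E by apply: (le_trans h); rewrite lee_pmul2l ?fin_numE.
by rewrite -EFinM lee_fin leNgt zk.
Qed.

Lemma error_bound_of_composed_nonlocal_slope :
  (forall u, far u -> (1 <= alpha%:E * nonlocal_slope (extend phi \o f) u)%E) -> eb.
Proof.
move=> h; apply: contrapT => /(error_bound_failure hphi cX lf al01 de0 xde).
move=> [u [k [fu k0 ak umin]]].
apply: (@scaled_contra k _ alpha al0 ak _ (h u fu)).
have [a a0 fa] := strip_fin fu.1.2.
apply: (@nonlocal_slope_le R X (extend phi \o f) u (phi a) k) => [||v].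
- by rewrite /= fa extend_fin// ltW.
- exact: ltW.
- rewrite (_ : maxe _ _ = extend phi (f v)); first exact: umin.
  by apply/max_idPl; exact: extend_ge0.
Qed.

Lemma error_bound_of_slope s : slope_ops0 f s ->
  (forall u, far u -> (1 <= (alpha * phi' (fine (f u)))%:E * s u)%E) -> eb.
Proof.
move=> hs h; apply: contrapT => /(error_bound_failure hphi cX lf al01 de0 xde).
move=> [u [k [fu k0 ak umin]]].
have [a a0 fa] := strip_fin fu.1.2.
have pa := class_C1_derive_gt0 hphi a0.
(* k / phi' a < c < c' < 1 / (alpha phi' a) *)
have ka : k < alpha^-1 by rewrite -(ltr_pM2l al0) divff// gt_eqF.
pose c := (k + alpha^-1) / 2 / phi' a; pose c' := (c + alpha^-1 / phi' a) / 2.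
have kc : k < c * phi' a by rewrite /c divfK ?gt_eqF//; lra.
have ca : c < alpha^-1 / phi' a by rewrite /c ltr_pM2r ?invr_gt0//; lra.
have c0 : 0 < c by rewrite /c divr_gt0// divr_gt0// addr_gt0// invr_gt0.
have cc' : c < c' by rewrite /c'; lra.
have c'0 : 0 < c' by lra.
have c'a : phi' a < alpha^-1 / c'.
  rewrite ltr_pdivlMr// mulrC -ltr_pdivlMr// /c'; lra.
have near_u := local_descent hphi fa a0 k0 umin lf c0 kc.
have [eta eta0 heta] := far_strip_open fu fa c'a.
have [x [b [ux fx ba sx]]] := slope_ops0_near hs cX lf fN fa (ltW c0) cc' eta0 near_u.
have [farx pb] := heta x b ux fx ba.
have b0 : 0 < b by move: farx.1.2 => /andP[+ _]; rewrite fx lte_fin.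
have := h x farx; rewrite fx /=.
apply: scaled_contra sx; first by rewrite mulr_gt0// class_C1_derive_gt0.
rewrite -mulrA -ltr_pdivlMl// mulr1 -ltr_pdivlMr//.
Qed.

Lemma error_bound_of_nonlocal_slope :
  (forall t1 t2 : R, 0 < t1 -> t1 <= t2 -> phi' t2 <= phi' t1) ->
  (forall u, far u ->
    (1 <= (alpha * phi' (fine (f u)))%:E * nonlocal_slope f u)%E) -> eb.
Proof.
move=> mono h; apply: contrapT => /(error_bound_failure hphi cX lf al01 de0 xde).
move=> [u [k [fu k0 ak umin]]].
have [a a0 fa] := strip_fin fu.1.2.
have pa := class_C1_derive_gt0 hphi a0.
have := h u fu; rewrite fa /=; apply: (@scaled_contra (k / phi' a)).
- exact: mulr_gt0.
- have -> // : alpha * phi' a * (k / phi' a) = alpha * k by field; rewrite gt_eqF.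
- apply: (nonlocal_slope_le fa); first by rewrite divr_ge0// ltW.
  exact: nonlocal_descent.
Qed.

End sufficiency.

Local Open Scope ereal_scope.

Theorem theorem4p1 (R : realType) (phi : R -> R) (delta mu : \bar R)
    (hphi : class_C1 phi) (hdelta : 0 < delta) (hmu : 0 < mu) :
  (forall (X : metricType R) (f : X -> \bar R) (xbar : X),
    proper_valued f ->
    (* (i) *)
    (forall alpha : R,
      complete_metric X -> lower_semicontinuous f ->
      (0 < alpha <= 1)%R ->
      sublevel0 f xbar \/ delta = +oo ->
      let near_set := [set u | (eball xbar delta `&` strip f mu) u /\
        (Num.max alpha (1 - alpha)%R)%:E * extend phi (f u)
          < dist_to u (sublevel0 f)] in
      let slope_condition (s : X -> \bar R) := forall u, near_set u ->
        1 <= (alpha * phi^`()%classic (fine (f u)))%:E * s u in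
      [\/ (* (a) *)
          forall u, near_set u ->
            1 <= alpha%:E * nonlocal_slope (extend phi \o f) u,
          (* (b) *)
          exists2 s, slope_ops0 f s & slope_condition s
        | (* (b) for nonincreasing phi' *)
          (forall t1 t2 : R, (0 < t1)%R -> (t1 <= t2)%R ->
             (phi^`()%classic t2 <= phi^`()%classic t1)%R) /\
          (exists2 s, slope_ops f s & slope_condition s)] ->
      error_bound phi f xbar (delta * ((1 + alpha)^-1)%:E) mu) /\
    (* (ii) *)
    (error_bound phi f xbar delta mu ->
      forall u, (eball xbar delta `&` strip f mu) u ->
        1 <= nonlocal_slope (extend phi \o f) u)) /\
  (* (iii) *)
  (forall (V : normedModType R) (f : V -> \bar R) (xbar : V),
    proper_valued f -> convex_efun f ->
    @error_bound R (normed_metric V) phi f xbar delta mu ->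
    (forall u : V,
      (@eball R (normed_metric V) xbar delta `&`
       @strip R (normed_metric V) f mu) u ->
      1 <= (phi (fine (f u)) / fine (f u))%:E *
           subdiff_slope (subdiff f) u) /\
    ((forall t1 t2 : R, (0 < t1)%R -> (t1 <= t2)%R ->
        (phi^`()%classic t1 <= phi^`()%classic t2)%R) \/
     convex_function (`[0%R, +oo[%classic : set (convex_lmodType R^o))
       (phi : convex_lmodType R^o -> R^o) ->
     forall u : V,
       (@eball R (normed_metric V) xbar delta `&`
        @strip R (normed_metric V) f mu) u ->
       1 <= (phi^`()%classic (fine (f u)))%:E *
            subdiff_slope (subdiff f) u)).
Proof.
split=> [X f xbar fN|V f xbar fN cvx eb].
  split=> [alpha cX lf al01 xde near_set slope_condition|eb u su]; last first.
    exact: error_bound_nonlocal_slope eb su.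
  case=> [h|[s hs h]|[mono [s [hs|->] h]]].
  - exact: error_bound_of_composed_nonlocal_slope.
  - exact: error_bound_of_slope hs h.
  - exact: error_bound_of_slope hs h.
  - exact: error_bound_of_nonlocal_slope.
have key (q : R) u : (@eball R (normed_metric V) xbar delta `&`
    @strip R (normed_metric V) f mu) u ->
    (phi (fine (f u)) / fine (f u) <= q)%R -> 1 <= q%:E * subdiff_slope (subdiff f) u.
  move=> su qle; have [a a0 fa] := @strip_fin R (normed_metric V) f mu u su.2.
  have pa0 := class_C1_gt0 hphi a0; rewrite fa /= in qle.
  have r0 : (0 < phi a / a)%R by rewrite divr_gt0.
  have := error_bound_subdiff_slope hphi eb su; rewrite fa /= => h.
  apply: (@le_trans _ _ (q%:E * (a / phi a)%:E)).
    rewrite -EFinM lee_fin (@le_trans _ _ (phi a / a * (a / phi a))%R)//.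
      by rewrite -mulrA (mulrA a^-1%R) mulVf ?gt_eqF// mul1r divff// gt_eqF.
    by rewrite ler_wpM2r// divr_ge0// ltW.
  by rewrite lee_pmul2l// lte_fin (lt_le_trans r0).
split=> [u su|mono u su]; first exact: key.
have [a a0 fa] := @strip_fin R (normed_metric V) f mu u su.2.
by apply: key => //; rewrite fa /=; exact: class_C1_ratio_le_derive.
Qed.
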